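(* Let $k$ be a division ring, let $n\ge 1$, and let $R\in\mathbf{RSPS}^n(k)$. Then the classical Krull dimension of $R$ (the supremum of lengths $t$ of chains $P_0\subsetneq P_1\subsetneq\dots\subsetneq P_t$ of prime ideals of $R$) equals $n$.
   Context: A ring $R$ is local if it has a unique maximal two-sided ideal $\mathfrak{m}$ and $R/\mathfrak{m}$ is simple artinian; a complete local ring is a local ring complete and separated in the $\mathfrak{m}$-adic topology (a division ring is one, with $\mathfrak{m}=0$). A skew derivation $(\sigma,\delta)$ of $R$ consists of a ring automorphism $\sigma$ and an additive map $\delta$ with $\delta(ab)=\delta(a)b+\sigma(a)\delta(b)$; it is local if $\sigma(\mathfrak{m})\subseteq\mathfrak{m}$, $\delta(R)\subseteq\mathfrak{m}$, $\delta(\mathfrak{m})\subseteq\mathfrak{m}^2$. For local $(\sigma,\delta)$, $R[[x;\sigma,\delta]]$ denotes the ring of formal series $\sum_{i\ge0}r_ix^i$ ($r_i\in R$) with multiplication extending that of $R$, $x^ix^j=x^{i+j}$, and $xa=\sigma(a)x+\delta(a)$ ($a\in R$); it is a complete local ring. $\mathbf{SPS}(R)$ is the class of such rings, and $\mathbf{SPS}^n(R)$ the class of $n$-fold iterates. For a complete local ring $R_0$ and $R\in\mathbf{SPS}^n(R_0)$, $R$ is called rigid, written $R\in\mathbf{RSPS}^n(R_0)$, if there is a chain $R_0\subsetneq R_1\subsetneq\dots\subsetneq R_n=R$ with $R_i=R_{i-1}[[x_i;\sigma_i,\delta_i]]\in\mathbf{SPS}(R_{i-1})$ for each $i$, which is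 stable: for all $0\le i<j\le n$, the maximal ideal $\mathfrak{m}_i$ of $R_i$ satisfies $\sigma_j(\mathfrak{m}_i)\subseteq\mathfrak{m}_i$ and $\delta_j(\mathfrak{m}_i)\subseteq\mathfrak{m}_i$. *)

(* Defs.v *)
From HB Require Import structures.
From mathcomp Require Import all_boot all_algebra.

Set Implicit Arguments.
Unset Strict Implicit.
Unset Printing Implicit Defensive.

Import GRing.Theory.
Local Open Scope ring_scope.

(* Convention: all rings considered are subrings of a fixed ambient ring R,
   represented by predicates A : R -> Prop.  Ideals of a subring A are
   predicates contained in A. *)

Section RingDefs.
Variable R : nzRingType.
Implicit Types (A B I J L : R -> Prop).

Definition subset_of A B := forall a, A a -> B a.

Definition strict_subset_of A B := subset_of A B /\ exists2 b, B b & ~ A b.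

Definition subring A :=
  A 1 /\ (forall a b, A a -> A b -> A (a - b)) /\
  (forall a b, A a -> A b -> A (a * b)).

Definition ideal_of A I :=
  subset_of I A /\ I 0 /\ (forall a b, I a -> I b -> I (a + b)) /\
  (forall a b, A a -> I b -> I (a * b) /\ I (b * a)).

Definition left_ideal_of A L :=
  subset_of L A /\ L 0 /\ (forall a b, L a -> L b -> L (a + b)) /\
  (forall a b, A a -> L b -> L (a * b)).

Inductive ideal_pow A I : nat -> R -> Prop :=
| ipow0 a : A a -> ideal_pow A I 0 a
| ipow_mul k a b : ideal_pow A I k a -> I b -> ideal_pow A I k.+1 (a * b)
| ipow_add k a b : ideal_pow A I k.+1 a -> ideal_pow A I k.+1 b ->
                   ideal_pow A I k.+1 (a + b).

Definition maximal_ideal_of A I :=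
  ideal_of A I /\ ~ I 1 /\
  (forall J, ideal_of A J -> ~ J 1 -> subset_of I J -> subset_of J I).

(* A/I is (left) artinian: descending chains of left ideals of A containing I
   (= left ideals of A/I) stabilize. *)
Definition quotient_artinian A I :=
  forall L : nat -> R -> Prop,
    (forall i, left_ideal_of A (L i) /\ subset_of I (L i)) ->
    (forall i, subset_of (L i.+1) (L i)) ->
    exists N, forall i, (N <= i)%N -> subset_of (L N) (L i).

(* A is a local ring with (unique) maximal two-sided ideal I, and A/I is
   simple (I maximal) artinian. *)
Definition local_ring_of A I :=
  subring A /\ maximal_ideal_of A I /\
  (forall J, maximal_ideal_of A J -> forall a, J a <-> I a) /\
  quotient_artinian A I.

Definition adic_lim A I (s : nat -> R) (l : R) :=
  forall k, exists N, forall p, (N <= p)%N -> ideal_pow A I k (l - s p).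

Definition adic_cauchy A I (s : nat -> R) :=
  forall k, exists N, forall p q, (N <= p)%N -> (N <= q)%N ->
    ideal_pow A I k (s p - s q).

Definition complete_local_ring_of A I :=
  local_ring_of A I /\
  (forall a, A a -> (forall k, ideal_pow A I k a) -> a = 0) /\
  (forall s, (forall p, A (s p)) -> adic_cauchy A I s ->
     exists2 l, A l & adic_lim A I s l).

Definition ring_automorphism_of A (s : R -> R) :=
  (forall a, A a -> A (s a)) /\
  (forall a b, A a -> A b -> s (a + b) = s a + s b) /\
  (forall a b, A a -> A b -> s (a * b) = s a * s b) /\
  s 1 = 1 /\
  (forall a b, A a -> A b -> s a = s b -> a = b) /\
  (forall b, A b -> exists2 a, A a & s a = b).

Definition skew_derivation_of A (s d : R -> R) :=
  ring_automorphism_of A s /\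
  (forall a, A a -> A (d a)) /\
  (forall a b, A a -> A b -> d (a + b) = d a + d b) /\
  (forall a b, A a -> A b -> d (a * b) = d a * b + s a * d b).

Definition local_skew_derivation_of A I (s d : R -> R) :=
  skew_derivation_of A s d /\
  (forall a, I a -> I (s a)) /\
  (forall a, A a -> I (d a)) /\
  (forall a, I a -> ideal_pow A I 2 (d a)).

Definition series_partial (r : nat -> R) (y : R) (N : nat) : R :=
  \sum_(j < N) r j * y ^+ j.

(* B = A[[y; s, d]] : inside R, B is the skew power series ring over the
   complete local ring (A, I) in the variable y, where J is the maximal ideal
   of B: y a = s(a) y + d(a), every formal series sum r_j y^j (r_j in A)
   converges J-adically in B, every element of B is such a sum, and the
   coefficients are unique. *)
Definition skew_power_series_ext A I B J (s d : R -> R) (y : R) :=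
  subring B /\ subset_of A B /\ subset_of I J /\
  local_skew_derivation_of A I s d /\
  B y /\ (forall a, A a -> y * a = s a * y + d a) /\
  (forall r : nat -> R, (forall j, A (r j)) ->
     exists2 b, B b & adic_lim B J (series_partial r y) b) /\
  (forall b, B b -> exists2 r : nat -> R, (forall j, A (r j)) &
     adic_lim B J (series_partial r y) b) /\
  (forall (r r' : nat -> R) b, (forall j, A (r j)) -> (forall j, A (r' j)) ->
     adic_lim B J (series_partial r y) b ->
     adic_lim B J (series_partial r' y) b -> forall j, r j = r' j).

Definition full_set : R -> Prop := fun _ => True.

Definition prime_ideal P :=
  ideal_of full_set P /\ ~ P 1 /\
  (forall I J, ideal_of full_set I -> ideal_of full_set J ->
     (forall a b, I a -> J b -> P (a * b)) ->
     subset_of I P \/ subset_of J P).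

Definition prime_chain (P : nat -> R -> Prop) (t : nat) :=
  (forall j, (j <= t)%N -> prime_ideal (P j)) /\
  (forall j, (j < t)%N -> strict_subset_of (P j) (P j.+1)).

Definition classical_krull_dim_eq (n : nat) :=
  (exists P, prime_chain P n) /\
  (forall P t, prime_chain P t -> (t <= n)%N).

End RingDefs.

(* R in RSPS^n(k): R is (isomorphic to) an n-fold rigid iterated skew power
   series ring over k; R_0 is the image of the embedding iota : k -> R. *)
Definition RSPS (k : nzRingType) (R : nzRingType) (iota : k -> R) (n : nat) :=
  exists (Rs m : nat -> R -> Prop) (sigma delta : nat -> R -> R) (x : nat -> R),
    (forall r, Rs 0%N r <-> exists a, r = iota a) /\
    (forall r, Rs n r) /\
    (forall i, (i <= n)%N -> complete_local_ring_of (Rs i) (m i)) /\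
    (forall i, (i < n)%N ->
       strict_subset_of (Rs i) (Rs i.+1) /\
       skew_power_series_ext (Rs i) (m i) (Rs i.+1) (m i.+1)
                             (sigma i.+1) (delta i.+1) (x i.+1)) /\
    (forall i j, (i < j)%N -> (j <= n)%N -> forall a, m i a ->
       m i (sigma j a) /\ m i (delta j a)).

(* Main.v *)
(** Every element of [R] is uniquely a series [\sum_a c_a x_1^(a_1) ... x_n^(a_n)] with
    [c_a] in [k], and the maximal ideal's powers are the sets of series of order [>= K].
    Order the exponents by total degree first, a larger power of the latest variable coming
    first in case of a tie.  Stability makes each [sigma_j] act on [m_i/m_i^2] by a
    triangular matrix and keeps the terms produced by [delta_j] later in this order, so the
    least exponent of a product is the sum of the least exponents.

    Lower bound: the series all of whose monomials involve one of [x_1, ..., x_j] form a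
    two-sided ideal (the closure of [m_j R]), completely prime because least exponents add;
    [j = 0, ..., n] gives a chain of length [n].

    Upper bound: division by a standard basis (Dickson's lemma) shows that [R] is left
    noetherian, with a uniform Artin-Rees shift.  By Goldie's argument, if [P] is a prime
    ideal strictly contained in an ideal [Q], some [c] in [Q] is left regular modulo [P].
    If [D] elements [b] are left [k]-independent modulo [Q + m^N], then the [N D] products
    [b c^i], [i < N], are independent modulo [P + m^(C N)] with [C] independent of [N].
    Hence a chain of length [t] forces [N^t = O(N^n)], as [R / m^N] has dimension at
    most [N^n]. *)

(* The direction of the tie-break is forced. In [x a = sigma(a) x + delta(a)] the term [delta(a)]
   gains one order and loses one power of [x], so it may tie in total degree with the main term; it
   has to come later, hence larger powers of the latest variable come first. The same rule puts
   [x_u] with [u < l] behind [x_l], so a linear term of [sigma_j(x_l)], which by stability only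
   involves [x_1, ..., x_l], is never ahead of [x_l] itself.

   Neither [k] nor [c] is central. Independence therefore concerns left [k]-combinations, and the
   powers of [c] stand on the right, where they leave the scalars alone. Cancelling such a right
   factor modulo [P] only asks that [a c] in [P] imply [a] in [P], so one-sided regularity is
   enough. The same cancellation modulo a power of the maximal ideal is Artin-Rees for the left
   ideal [P + R c]; its shift is paid once for each power of [c], whence a precision linear in
   [N]. *)
Require Import Defs.
From HB Require Import structures.
From mathcomp Require Import all_boot all_algebra.
From mathcomp Require Import zify.
From Stdlib Require Import Classical ClassicalEpsilon.
Set Implicit Arguments.
Unset Strict Implicit.
Unset Printing Implicit Defensive.
Import GRing.Theory.
Local Open Scope ring_scope.

(** * Preliminaries *)

(* [zmod] decides equalities in an abelian group by comparing integer coefficients of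
   atoms; [ring] is not available in noncommutative rings. *)
Inductive zexp := ZVar of nat | ZZero | ZAdd of zexp & zexp | ZOpp of zexp.
Fixpoint zexp_eval (V : zmodType) (env : seq V) e : V :=
  match e with
  | ZVar i => nth 0 env i | ZZero => 0
  | ZAdd e f => zexp_eval env e + zexp_eval env f | ZOpp e => - zexp_eval env e end.
Fixpoint zexp_coef e (i : nat) : int :=
  match e with
  | ZVar j => if j == i then 1 else 0 | ZZero => 0
  | ZAdd e f => zexp_coef e i + zexp_coef f i | ZOpp e => - zexp_coef e i end.

Lemma zexp_evalE (V : zmodType) (env : seq V) e :
  zexp_eval env e = \sum_(i < size env) nth 0 env i *~ zexp_coef e i.
Proof.
elim: e => [j||e IHe f IHf|e IH] /=.
- case: (ltnP j (size env)) => hj.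
    rewrite (bigD1 (Ordinal hj)) //= eqxx big1 ?addr0 ?mulr1z // => i.
    by rewrite -val_eqE /= eq_sym => /negPf ->; rewrite mulr0z.
  rewrite nth_default // big1 // => i _.
  by case: eqP => [e|]; rewrite ?mulr0z //; move: hj; rewrite e leqNgt ltn_ord.
- by rewrite big1 // => i _; rewrite mulr0z.
- by rewrite IHe IHf -big_split; apply: eq_bigr => i _; rewrite mulrzDr.
- by rewrite IH -sumrN; apply: eq_bigr => i _; rewrite mulrNz.
Qed.

Lemma zexp_eqP (V : zmodType) (env : seq V) e f :
  all (fun i => zexp_coef e i == zexp_coef f i) (iota 0 (size env)) -> zexp_eval env e = zexp_eval env f.
Proof.
move=> /allP h; rewrite !zexp_evalE; apply: eq_bigr => i _; congr (_ *~ _).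
by apply/eqP/h; rewrite mem_iota /=.
Qed.

(** Matching on [constr:(Set)] only serves to run [unify] inside a tactic that returns a term; its
    failure selects the next branch. *)
Ltac zatom l x :=
  let rec go m := lazymatch m with
    | cons ?a ?m' => match constr:(Set) with
        | _ => let _ := match constr:(Set) with _ => unify a x end in constr:(O)
        | _ => let n := go m' in constr:(S n) end
    end in go l.
Ltac zinsert l x :=
  let rec go m := lazymatch m with
    | cons ?a ?m' => match constr:(Set) with
        | _ => let _ := match constr:(Set) with _ => unify a x end in l
        | _ => go m' end
    | _ => constr:(cons x l) end in go l.
Ltac zcollect l t :=
  lazymatch t with
  | @GRing.add _ ?a ?b => let l1 := zcollect l a in zcollect l1 b
  | @GRing.opp _ ?a => zcollect l a
  | @GRing.zero _ => l
  | _ => zinsert l t end.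
Ltac zreify l t :=
  lazymatch t with
  | @GRing.add _ ?a ?b => let x := zreify l a in let y := zreify l b in constr:(ZAdd x y)
  | @GRing.opp _ ?a => let x := zreify l a in constr:(ZOpp x)
  | @GRing.zero _ => constr:(ZZero)
  | _ => let n := zatom l t in constr:(ZVar n) end.
Ltac zmod :=
  lazymatch goal with |- @eq ?T ?a ?b =>
    let l0 := zcollect (@nil T) a in
    let l := zcollect l0 b in
    let x := zreify l a in let y := zreify l b in
    exact: (@zexp_eqP _ l x y isT) end.

Lemma fun_choice (X Y : Type) (P : X -> Y -> Prop) :
  (forall x, exists y, P x y) -> exists f, forall x, P x (f x).
Proof.
move=> h; exists (fun x => proj1_sig (constructive_indefinite_description _ (h x))) => x.
by case: constructive_indefinite_description.
Qed.

Section IdealPow.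
Variable R : nzRingType.
Variables A I : R -> Prop.
Hypothesis hA : subring A.
Hypothesis hI : ideal_of A I.
Local Notation pw := (ideal_pow A I).

Lemma subring1 : A 1. Proof. by case: hA. Qed.
Lemma subringB a b : A a -> A b -> A (a - b).
Proof. by case: hA => _ [h _]; apply: h. Qed.
Lemma subringM a b : A a -> A b -> A (a * b).
Proof. by case: hA => _ [_ h]; apply: h. Qed.
Lemma subring0 : A 0.
Proof. by rewrite -(subrr 1); apply: subringB; apply: subring1. Qed.
Lemma subringN a : A a -> A (- a).
Proof. by move=> ha; rewrite -[- a]sub0r; apply: subringB => //; apply: subring0. Qed.
Lemma subringD a b : A a -> A b -> A (a + b).
Proof. by move=> ha hb; rewrite -[b]opprK; apply: subringB => //; apply: subringN. Qed.
Lemma subringX a n : A a -> A (a ^+ n).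
Proof.
move=> ha; elim: n => [|n IH]; first by rewrite expr0; apply: subring1.
by rewrite exprS; apply: subringM.
Qed.
Lemma subring_sum (T : Type) (s : seq T) (P : pred T) (F : T -> R) :
  (forall i, P i -> A (F i)) -> A (\sum_(i <- s | P i) F i).
Proof. by move=> h; apply: big_ind => //; [exact: subring0 | exact: subringD]. Qed.

Lemma ideal_sub a : I a -> A a. Proof. by case: hI => h _; apply: h. Qed.
Lemma ideal0 : I 0. Proof. by case: hI => _ [h _]. Qed.
Lemma idealD a b : I a -> I b -> I (a + b).
Proof. by case: hI => _ [_ [h _]]; apply: h. Qed.
Lemma idealMl a b : A a -> I b -> I (a * b).
Proof. by case: hI => _ [_ [_ h]] ha hb; case: (h a b ha hb). Qed.
Lemma idealMr a b : I a -> A b -> I (a * b).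
Proof. by case: hI => _ [_ [_ h]] ha hb; case: (h b a hb ha). Qed.
Lemma idealN a : I a -> I (- a).
Proof. by move=> h; rewrite -mulN1r; apply: idealMl => //; apply: subringN; apply: subring1. Qed.
Lemma idealB a b : I a -> I b -> I (a - b).
Proof. by move=> ha hb; apply: idealD => //; apply: idealN. Qed.

Lemma ipow_sub k a : pw k a -> A a.
Proof.
elim=> {k a} // k a b.
  by move=> _ ha hb; apply: subringM => //; apply: ideal_sub.
by move=> _ ha _ hb; apply: subringD.
Qed.

Lemma ipowMl k a b : A a -> pw k b -> pw k (a * b).
Proof.
move=> ha; elim=> {k b} [b hb|k b c hb IH hc|k b c _ IHb _ IHc].
- by apply: ipow0; apply: subringM.
- by rewrite mulrA; apply: ipow_mul.
- by rewrite mulrDr; apply: ipow_add.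
Qed.

Lemma ipowMr k a b : pw k a -> A b -> pw k (a * b).
Proof.
move=> + hb; elim=> {k a} [a ha|k a c ha IH hc|k a c _ IHa _ IHc].
- by apply: ipow0; apply: subringM.
- by rewrite -mulrA; apply: ipow_mul => //; apply: idealMr.
- by rewrite mulrDl; apply: ipow_add.
Qed.

Lemma ipow_zero k : pw k 0.
Proof.
case: k => [|k]; first by apply: ipow0; apply: subring0.
elim: k => [|k IH]; rewrite -(mulr0 0); apply: ipow_mul => //; try exact: ideal0.
by apply: ipow0; exact: subring0.
Qed.

Lemma ipowD k a b : pw k a -> pw k b -> pw k (a + b).
Proof.
case: k => [|k] ha hb; last exact: ipow_add.
by apply: ipow0; apply: subringD; [apply: ipow_sub ha | apply: ipow_sub hb].
Qed.
Lemma ipowN k a : pw k a -> pw k (- a).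
Proof. by move=> h; rewrite -mulN1r; apply: ipowMl => //; apply: subringN; apply: subring1. Qed.
Lemma ipowB k a b : pw k a -> pw k b -> pw k (a - b).
Proof. by move=> ha hb; apply: ipowD => //; apply: ipowN. Qed.
Lemma ipowBC k a b : pw k (a - b) -> pw k (b - a).
Proof. by move=> h; rewrite -opprB; apply: ipowN. Qed.
Lemma ipow_trans k a b c : pw k (a - b) -> pw k (b - c) -> pw k (a - c).
Proof. by move=> h h'; rewrite -(subrK b a) -addrA; apply: ipowD. Qed.
Lemma ipow_sum k (T : Type) (s : seq T) (P : pred T) (F : T -> R) :
  (forall i, P i -> pw k (F i)) -> pw k (\sum_(i <- s | P i) F i).
Proof. by move=> h; apply: big_ind => //; [exact: ipow_zero | exact: ipowD]. Qed.

Lemma ipowS k a : pw k.+1 a -> pw k a.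
Proof.
move e: k.+1 => k' h; elim: h k e => {k' a} // k1 a b.
  by move=> ha _ hb j [->]; apply: ipowMr => //; apply: ideal_sub.
by move=> _ IHa _ IHb j e; apply: ipowD; [apply: IHa | apply: IHb].
Qed.
Lemma ipow_le k l a : (l <= k)%N -> pw k a -> pw l a.
Proof.
move=> /subnK <-; elim: (k - l)%N => // j IH; rewrite addSn => /ipowS; exact: IH.
Qed.

Lemma ipowM k l a b : pw k a -> pw l b -> pw (k + l) (a * b).
Proof.
move=> ha hb; elim: hb a ha => {l b} [b hb|l b c hb IH hc|l b c _ IHb _ IHc] a ha.
- by rewrite addn0; apply: ipowMr.
- by rewrite mulrA addnS; apply: ipow_mul => //; apply: IH.
- by rewrite mulrDr; apply: ipowD; [apply: IHb | apply: IHc].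
Qed.

Lemma ideal_ipow1 a : I a -> pw 1 a.
Proof. by move=> h; rewrite -[a]mul1r; apply: ipow_mul => //; apply: ipow0; exact: subring1. Qed.

Lemma ipowS_ideal k a : pw k.+1 a -> I a.
Proof.
move e: k.+1 => k' h; elim: h k e => {k' a} // k1 a b.
  by move=> ha _ hb j _; apply: idealMl => //; apply: ipow_sub ha.
by move=> _ IHa _ IHb j e; apply: idealD; [apply: IHa e | apply: IHb e].
Qed.

End IdealPow.

Lemma ipow_mono (R : nzRingType) (A I B J : R -> Prop) k a :
  subset_of A B -> subset_of I J -> ideal_pow A I k a -> ideal_pow B J k a.
Proof.
move=> hAB hIJ; elim=> {k a} [a ha|k a b _ IH hb|k a b _ IHa _ IHb].
- by apply: ipow0; apply: hAB.
- by apply: ipow_mul => //; apply: hIJ.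
- exact: ipow_add.
Qed.
(** * One skew power series extension *)

Section Extension.
Variable R : nzRingType.
Variables A I B J : R -> Prop.
Variables (s d : R -> R) (y : R).
Hypothesis hcA : complete_local_ring_of A I.
Hypothesis hcB : complete_local_ring_of B J.
Hypothesis hE : skew_power_series_ext A I B J s d y.
Hypothesis hres : forall a, A a -> I a \/ exists2 b, A b & I (b * a - 1).
Local Notation pI := (ideal_pow A I).
Local Notation pJ := (ideal_pow B J).

Let hA : subring A. Proof. by case: hcA => [[]]. Qed.
Let hB : subring B. Proof. by case: hcB => [[]]. Qed.
Let hI : ideal_of A I. Proof. by case: hcA => [[_ [[]]]]. Qed.
Let hJ : ideal_of B J. Proof. by case: hcB => [[_ [[]]]]. Qed.
Let J1 : ~ J 1. Proof. by case: hcB => [[_ [[_ []]]]]. Qed.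
Let Jmax K : ideal_of B K -> ~ K 1 -> subset_of J K -> subset_of K J.
Proof. by case: hcB => [[_ [[_ [_ h]] _]] _]; apply: h. Qed.
Let AB : subset_of A B. Proof. by case: hE => _ []. Qed.
Let IJ : subset_of I J. Proof. by case: hE => _ [_ []]. Qed.
Let hsd : local_skew_derivation_of A I s d. Proof. by case: hE => _ [_ [_ []]]. Qed.
Let By : B y. Proof. by case: hE => _ [_ [_ [_ []]]]. Qed.
Let yM a : A a -> y * a = s a * y + d a.
Proof. by case: hE => _ [_ [_ [_ [_ [h _]]]]]; apply: h. Qed.
Let sA a : A a -> A (s a). Proof. by case: hsd => [[[h _] _] _]; apply: h. Qed.
Let sD a b : A a -> A b -> s (a + b) = s a + s b.
Proof. by case: hsd => [[[_ [h _]] _] _]; apply: h. Qed.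
Let sM a b : A a -> A b -> s (a * b) = s a * s b.
Proof. by case: hsd => [[[_ [_ [h _]]] _] _]; apply: h. Qed.
Let dD a b : A a -> A b -> d (a + b) = d a + d b.
Proof. by case: hsd => [[_ [_ [h _]]] _]; apply: h. Qed.
Let dM a b : A a -> A b -> d (a * b) = d a * b + s a * d b.
Proof. by case: hsd => [[_ [_ [_ h]]] _]; apply: h. Qed.
Let sI a : I a -> I (s a). Proof. by case: hsd => _ [h _]; apply: h. Qed.
Let dI a : A a -> I (d a). Proof. by case: hsd => _ [_ [h _]]; apply: h. Qed.
Let dI2 a : I a -> pI 2 (d a). Proof. by case: hsd => _ [_ [_ h]]; apply: h. Qed.

Lemma sigma_ipow k a : pI k a -> pI k (s a).
Proof.
elim=> {k a} [a ha|k a b ha IH hb|k a b ha IHa hb IHb].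
- by apply: ipow0; apply: sA.
- rewrite sM; [|exact: ipow_sub ha|exact: (ideal_sub hI)].
  by apply: ipow_mul => //; apply: sI.
- by rewrite sD; [apply: ipow_add|exact: ipow_sub ha|exact: ipow_sub hb].
Qed.

(** The order gained by [d] compensates the power of [y] lost in [y a = s a y + d a]. Convergence of
    products and the comparison of exponents both rest on this. *)
Lemma delta_ipow k a : pI k a -> pI k.+1 (d a).
Proof.
elim=> {k a} [a ha|k a b ha IH hb|k a b ha IHa hb IHb].
- by apply: (ideal_ipow1 hA); apply: dI.
- rewrite dM; [|exact: ipow_sub ha|exact: (ideal_sub hI)].
  apply: (ipowD hA hI); first exact: ipow_mul.
  by rewrite -addn2; apply: (ipowM hA hI) (dI2 hb); apply: sigma_ipow.
- by rewrite dD; [apply: (ipowD hA hI)|exact: ipow_sub ha|exact: ipow_sub hb].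
Qed.

Definition coefs (r : nat -> R) (b : R) :=
  (forall j, A (r j)) /\ adic_lim B J (series_partial r y) b.

Lemma coefs_ex b : B b -> exists r, coefs r b.
Proof. by case: hE => _ [_ [_ [_ [_ [_ [_ [h _]]]]]]] /h [r]; exists r. Qed.

Lemma coefs_series r : (forall j, A (r j)) -> exists2 b, B b & coefs r b.
Proof. by case: hE => _ [_ [_ [_ [_ [_ [h _]]]]]] hr; case: (h r hr) => b; exists b. Qed.

Lemma coefs_uniq r r' b : coefs r b -> coefs r' b -> r =1 r'.
Proof.
by case: hE => _ [_ [_ [_ [_ [_ [_ [_ h]]]]]]] [h1 h2] [h3 h4]; apply: (h r r' b).
Qed.

Lemma partialA r N : (forall j, A (r j)) -> B (series_partial r y N).
Proof.
move=> hr; apply: (subring_sum hB) => i _.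
by apply: (subringM hB); [apply: AB|apply: (subringX hB)].
Qed.

(** The series with all coefficients 1 converges [J]-adically, so two consecutive partial sums,
    which differ by a power of [y], end up congruent modulo [J]. *)
Lemma var_nilpotent_mod_J : exists N, J (y ^+ N).
Proof.
have h1 : forall j : nat, A ((fun=> 1) j) by move=> _; apply: (subring1 hA).
have [b _ [_ hb]] := coefs_series h1.
have [N hN] := hb 1%N.
exists N; have := hN N (leqnn N); have := hN N.+1 (leqnSn N).
rewrite /series_partial big_ord_recr /= mul1r.
move=> hS hN'; have := ipowB hB hJ hN' hS.
set P := \sum_(i < N) _ => h; have := ipowS_ideal hB hJ h.
by have -> : b - P - (b - (P + y ^+ N)) = y ^+ N by zmod.
Qed.

(* As [delta] maps into [I] and [sigma] is onto, [J + B y] is a two-sided ideal; it is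
   proper since [y] is nilpotent modulo [J], hence equal to the maximal ideal [J]. *)
Lemma var_in_J : J y.
Proof.
have [N hN] := var_nilpotent_mod_J.
pose K b := B b /\ exists2 a, B a & J (b - a * y).
have ycong c : B c -> exists2 a, B a & J (y * c - a * y).
  move=> /coefs_ex [r [hr hl]]; have [M hM] := hl 1%N.
  have := ipowS_ideal hB hJ (hM M (leqnn M)); set p := series_partial _ _ _ => hp.
  have [a ha hap] : exists2 a, B a & J (y * p - a * y).
    exists (\sum_(j < M) s (r j) * y ^+ j).
      apply: (subring_sum hB) => i _.
      by apply: (subringM hB); [apply: AB; apply: sA|apply: (subringX hB)].
    rewrite mulr_sumr mulr_suml -sumrB; apply: big_ind => //.
    - exact: (ideal0 hJ).
    - exact: (idealD hJ).
    - move=> i _; rewrite mulrA yM // mulrDl -!mulrA -exprS -exprSr [X in X - _]addrC addrK.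
      by apply: (idealMr hJ); [apply: IJ; apply: dI|apply: (subringX hB)].
  exists a => //; rewrite -[y * c](subrK (y * p)) -addrA; apply: (idealD hJ) => //.
  by rewrite -mulrBr; apply: (idealMl hJ).
have hK : ideal_of B K.
  split; first by move=> b [].
  split; first by split; [exact: (subring0 hB)|exists 0; [exact: (subring0 hB)|rewrite mul0r subr0; exact: (ideal0 hJ)]].
  split.
    move=> a b [ha [a' ha' ka]] [hb [b' hb' kb]]; split; first exact: (subringD hB).
    exists (a' + b'); first exact: (subringD hB).
    by rewrite mulrDl opprD addrACA; apply: (idealD hJ).
  move=> a b ha [hb [b' hb' kb]]; split; split; try exact: (subringM hB).
    exists (a * b'); first exact: (subringM hB).
    by rewrite -mulrA -mulrBr; apply: (idealMl hJ).
  have [c hc kc] := ycong a ha.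
  exists (b' * c); first exact: (subringM hB).
  rewrite -[b * a](subrK (b' * y * a)) -addrA -mulrBl.
  apply: (idealD hJ); first exact: (idealMr hJ).
  by rewrite -!mulrA -mulrBr; apply: (idealMl hJ).
have K1 : ~ K 1.
  case=> _ [a ha h1].
  (* Iterating [1 = a y] modulo [J]; at [M = N] the power of [y] is in [J], hence so is 1. *)
  have hind M : J (1 - a ^+ M * y ^+ M).
    elim: M => [|M IH]; first by rewrite !expr0 mulr1 subrr; exact: (ideal0 hJ).
    rewrite -[1](subrK (a ^+ M * y ^+ M)) -addrA; apply: (idealD hJ) => //.
    rewrite exprSr exprS -mulrA [a * _]mulrA -mulrBr.
    rewrite -[X in _ * (X - _)]mul1r -mulrBl.
    apply: (idealMl hJ); first exact: (subringX hB).
    by apply: (idealMr hJ) => //; exact: (subringX hB).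
  apply: J1; rewrite -[1](subrK (a ^+ N * y ^+ N)); apply: (idealD hJ) => //.
  by apply: (idealMl hJ) => //; exact: (subringX hB).
apply: (Jmax hK K1).
  by move=> b hb; split; [exact: (ideal_sub hJ)|exists 0; [exact: (subring0 hB)|rewrite mul0r subr0]].
split=> //; exists 1; first exact: (subring1 hB).
by rewrite mul1r subrr; exact: (ideal0 hJ).
Qed.

(** By [hres], an element of [A] outside [I] has a left inverse modulo [I], hence modulo [J], and
    cannot lie in the proper ideal [J]. *)
Lemma J_meet_A a : A a -> J a -> I a.
Proof.
move=> ha hJa; case: (hres ha) => // [[b hb /IJ h]].
case: J1; rewrite -[1](subKr (b * a)); apply: (idealB hB hJ) => //.
by apply: (idealMl hJ) => //; apply: AB.
Qed.

Lemma Ipow_Jpow k a : pI k a -> pJ k a.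
Proof. exact: ipow_mono AB IJ. Qed.

Lemma var_Jpow k : pJ k (y ^+ k).
Proof.
elim: k => [|k IH]; first by apply: ipow0; exact: (subring1 hB).
by rewrite exprSr; apply: ipow_mul => //; exact: var_in_J.
Qed.

Lemma Ipow_var_Jpow k a j : pI k a -> pJ (k + j) (a * y ^+ j).
Proof. by move=> h; apply: (ipowM hB hJ); [apply: Ipow_Jpow|apply: var_Jpow]. Qed.

(** As [y] lies in [J], all terms from [y^K] on lie in [J^K]: the unspecified rate of convergence
    becomes explicit. *)
Lemma coefs_mod r b K : coefs r b -> pJ K (b - series_partial r y K).
Proof.
case=> hr /(_ K) [N hN].
pose M := maxn N K; apply: (ipow_trans hB hJ (hN M (leq_maxl _ _))).
have hKM : (K <= M)%N := leq_maxr _ _.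
rewrite /series_partial -(subnKC hKM) big_split_ord /= [X in X - _]addrC addrK.
apply: (ipow_sum hB hJ) => i _; apply: (ipow_le hB hJ (leq_addr i K)).
apply: (ipowMl hB); [exact: AB|exact: var_Jpow].
Qed.

Lemma coefs_intro r b : (forall j, A (r j)) ->
  (forall K, exists2 M, (K <= M)%N & pJ K (b - series_partial r y M)) -> coefs r b.
Proof.
move=> hr h; split=> // K; exists K => p hp.
have [M hM h'] := h K.
have aux N N' : (K <= N)%N -> (N <= N')%N ->
    pJ K (series_partial r y N' - series_partial r y N).
  move=> hKN hN; rewrite /series_partial -(subnKC hN) big_split_ord /= [X in X - _]addrC addrK.
  apply: (ipow_sum hB hJ) => i _; apply: (ipow_le hB hJ (leq_trans hKN (leq_addr i N))).
  by apply: (ipowMl hB); [exact: AB|exact: var_Jpow].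
apply: (ipow_trans hB hJ h'); case: (leqP p M) => hpM; first exact: aux.
by apply: (ipowBC hB); apply: aux => //; apply: ltnW.
Qed.

Lemma coefs_fin r b M : (forall j, A (r j)) -> (forall j, (M <= j)%N -> r j = 0) ->
  b = \sum_(j < M) r j * y ^+ j -> coefs r b.
Proof.
move=> hr h0 ->; apply: coefs_intro => // K; exists (maxn M K); first exact: leq_maxr.
rewrite /series_partial -(subnKC (leq_maxl M K)) big_split_ord /= opprD addNKr.
rewrite big1 ?oppr0; first exact: (ipow_zero hB hJ).
by move=> i _; rewrite h0 ?mul0r // leq_addr.
Qed.

Lemma coefsB r r' a b : coefs r a -> coefs r' b -> coefs (fun j => r j - r' j) (a - b).
Proof.
move=> [hr h] [hr' h']; apply: coefs_intro; first by move=> j; apply: (subringB hA).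
move=> K; have [N hN] := h K; have [N' hN'] := h' K.
exists (maxn K (maxn N N')); first exact: leq_maxl.
set M := maxn K _.
have -> : series_partial (fun j => r j - r' j) y M =
  series_partial r y M - series_partial r' y M.
  by rewrite /series_partial -sumrB; apply: eq_bigr => i _; rewrite mulrBl.
have -> : a - b - (series_partial r y M - series_partial r' y M) =
  (a - series_partial r y M) - (b - series_partial r' y M) by zmod.
by apply: (ipowB hB hJ); [apply: hN|apply: hN']; rewrite /M; lia.
Qed.

Lemma coefsMl r a b : A a -> coefs r b -> coefs (fun j => a * r j) (a * b).
Proof.
move=> ha [hr h]; apply: coefs_intro; first by move=> j; apply: (subringM hA).
move=> K; have [N hN] := h K; exists (maxn K N); first exact: leq_maxl.
have -> M : series_partial (fun j => a * r j) y M = a * series_partial r y M.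
  by rewrite /series_partial mulr_sumr; apply: eq_bigr => i _; rewrite mulrA.
rewrite -mulrBr; apply: (ipowMl hB); first exact: AB.
by apply: hN; exact: leq_maxr.
Qed.

Lemma coefsMy a l : A a -> coefs (fun j => if j == l then a else 0) (a * y ^+ l).
Proof.
move=> ha; apply: (@coefs_fin _ _ l.+1).
- by move=> j; case: eqP => // _; exact: (subring0 hA).
- by move=> j hj; case: eqP => // e; move: hj; rewrite e ltnn.
- rewrite big_ord_recr /= eqxx big1 ?add0r // => i _.
  by case: eqP => [e|]; [have := ltn_ord i; rewrite e ltnn|rewrite mul0r].
Qed.

Let s0 : s 0 = 0.
Proof.
have h : s 0 = s 0 + s 0 by rewrite -sD ?addr0 //; exact: (subring0 hA).
by rewrite -[LHS](addrK (s 0)) -h subrr.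
Qed.
Let d0 : d 0 = 0.
Proof.
have h : d 0 = d 0 + d 0 by rewrite -dD ?addr0 //; exact: (subring0 hA).
by rewrite -[LHS](addrK (d 0)) -h subrr.
Qed.

(* [expand j t a] is the coefficient of [y ^+ t] in [y ^+ j * a]. *)
Fixpoint expand j t a : R :=
  match j with
  | 0 => if t is 0 then a else 0
  | j'.+1 => (if t is t'.+1 then s (expand j' t' a) else 0) + d (expand j' t a)
  end.

(** Passing from [y^j] to [y^t] takes [j - t] applications of [d], and each of them gains one
    order. *)
Lemma expand_pow k j t a : pI k a -> pI (k + (j - t)) (expand j t a).
Proof.
move=> ha; elim: j t => [|j IH] t /=.
  by case: t => [|t]; [rewrite addn0|exact: (ipow_zero hA hI)].
apply: (ipowD hA hI).
  case: t => [|t]; first exact: (ipow_zero hA hI).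
  by rewrite subSS; apply: sigma_ipow.
by apply: (ipow_le hA hI _ (delta_ipow (IH t))); lia.
Qed.

Lemma expandA j t a : A a -> A (expand j t a).
Proof. by move=> ha; apply: (ipow_sub hA hI); apply: expand_pow; apply: (ipow0 I ha). Qed.

Lemma expand_gt j t a : (j < t)%N -> expand j t a = 0.
Proof.
elim: j t => [|j IH] [|t] //= h.
by rewrite !IH // ?s0 ?d0 ?addr0 //; apply: ltnW.
Qed.

Lemma expand_diag j a : expand j j a = iter j s a.
Proof.
elim: j => // j IH; rewrite iterS -IH /= [expand j j.+1 a]expand_gt // d0 addr0 //.
Qed.

Lemma var_pow_mul j M a : A a -> (j < M)%N -> y ^+ j * a = \sum_(t < M) expand j t a * y ^+ t.
Proof.
move=> ha; elim: j M => [|j IH] [|M] // h.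
  rewrite expr0 mul1r big_ord_recl /= expr0 mulr1 big1 ?addr0 // => i _.
  by rewrite mul0r.
rewrite exprS -mulrA (IH M) // mulr_sumr.
have e (i : 'I_M) : y * (expand j i a * y ^+ i) =
    s (expand j i a) * y ^+ i.+1 + d (expand j i a) * y ^+ i.
  by rewrite mulrA yM ?mulrDl -?mulrA -?exprS //; exact: expandA.
under eq_bigr => i _ do rewrite e.
rewrite big_split /=.
under [RHS]eq_bigr => i _ do rewrite mulrDl.
rewrite big_split /= big_ord_recl mul0r add0r; congr (_ + _).
by rewrite big_ord_recr /= [expand j M a]expand_gt // d0 mul0r addr0.
Qed.

Definition prodcoef N (r u : nat -> R) m :=
  \sum_(j < N) \sum_(l < m.+1) r j * expand j (m - l) (u l).

Lemma prodcoefA N r u m : (forall j, A (r j)) -> (forall j, A (u j)) -> A (prodcoef N r u m).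
Proof.
move=> hr hu; apply: (subring_sum hA) => j _; apply: (subring_sum hA) => l _.
by apply: (subringM hA) => //; apply: expandA.
Qed.

Lemma prodcoef_stable N N' Q r u m : (forall j, A (r j)) -> (forall j, A (u j)) ->
  (m + Q <= N)%N -> (N <= N')%N -> pI Q (prodcoef N' r u m - prodcoef N r u m).
Proof.
move=> hr hu h1 h2; rewrite /prodcoef -(subnKC h2) big_split_ord /= [X in X - _]addrC addrK.
apply: (ipow_sum hA hI) => j _; apply: (ipow_sum hA hI) => l _.
apply: (ipowMl hA) => //; apply: (ipow_le hA hI _ (expand_pow _ _ (ipow0 I (hu l)))).
lia.
Qed.

Lemma big_triangle (V : nmodType) (F : nat -> nat -> V) Q :
  \sum_(m < Q) \sum_(l < m.+1) F l m = \sum_(l < Q) \sum_(t < Q - l) F l (t + l)%N.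
Proof.
elim: Q => [|Q IH]; first by rewrite !big_ord0.
rewrite !big_ord_recr /= IH subSnn big_ord1 add0n addrA -big_split /=; congr (_ + _).
by apply: eq_bigr => i _; rewrite subSn ?big_ord_recr /= ?subnK // ltnW.
Qed.

(* The coefficients of a product are infinite sums, of which [prodcoef N] is a truncation. *)
Lemma coefs_mul r u a b : B a -> B b -> coefs r a -> coefs u b ->
  exists2 p, coefs p (a * b) &
    forall m Q N, (m + Q <= N)%N -> pI Q (p m - prodcoef N r u m).
Proof.
move=> Ba Bb ha hb; have [hr _] := ha; have [hu _] := hb.
have /fun_choice [p hp] : forall m, exists l, A l /\ adic_lim A I (fun N => prodcoef N r u m) l.
  move=> m; have [_ [_ hc]] := hcA.
  have [||l hl hl'] := hc (fun N => prodcoef N r u m).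
  - by move=> N; apply: prodcoefA.
  - move=> Q; exists (m + Q)%N => N N' h h'.
    case: (leqP N N') => hN; last by apply: prodcoef_stable => //; apply: ltnW.
    by apply: (ipowBC hA); apply: prodcoef_stable.
  - by exists l.
have hpQ m Q N : (m + Q <= N)%N -> pI Q (p m - prodcoef N r u m).
  move=> h; have [_ /(_ Q) [N0 hN0]] := hp m.
  apply: (ipow_trans hA hI (hN0 (maxn N0 N) (leq_maxl _ _))).
  by apply: prodcoef_stable => //; exact: leq_maxr.
exists p => //.
have [c Bc hc] := coefs_series (fun m => proj1 (hp m)).
suff -> : a * b = c by [].
apply/eqP; rewrite -subr_eq0; apply/eqP.
have [_ [hsep _]] := hcB; apply: hsep; first by apply: (subringB hB) => //; apply: (subringM hB).
(* Only coefficients of index [m < Q] matter, and [hpQ] at precision [Q] asks for [m + Q <= N]. *)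
move=> Q; pose N := (Q + Q)%N.
pose aN := series_partial r y N; pose bQ := series_partial u y Q.
have BaN : B aN by apply: partialA.
have h1 : pJ Q (a * b - aN * bQ).
  have -> : a * b - aN * bQ = (a - aN) * b + aN * (b - bQ).
    by rewrite mulrBl mulrBr; zmod.
  apply: (ipowD hB hJ).
    by apply: (ipowMr hB hJ) => //; apply: (ipow_le hB hJ _ (coefs_mod N ha)); rewrite /N; lia.
  by apply: (ipowMl hB) => //; exact: coefs_mod.
have h2 : pJ Q (c - series_partial (prodcoef N r u) y Q).
  apply: (ipow_trans hB hJ (coefs_mod Q hc)).
  rewrite /series_partial -sumrB; apply: (ipow_sum hB hJ) => m _; rewrite -mulrBl.
  apply: (ipow_le hB hJ _ (Ipow_var_Jpow m (hpQ m Q N _))); first by lia.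
  by rewrite /N; have := ltn_ord m; lia.
(* After reindexing by [big_triangle], only monomials of degree at least [Q] in [y] survive in the
   difference. *)
have h3 : pJ Q (aN * bQ - series_partial (prodcoef N r u) y Q).
  rewrite /series_partial /prodcoef.
  under [X in _ - X]eq_bigr => m _ do rewrite mulr_suml.
  rewrite exchange_big /= mulr_suml -sumrB; apply: (ipow_sum hB hJ) => j _.
  under [X in _ - X]eq_bigr => m _ do rewrite mulr_suml.
  rewrite (@big_triangle _ (fun l m => r j * expand j (m - l) (u l) * y ^+ m)).
  rewrite mulr_sumr -sumrB; apply: (ipow_sum hB hJ) => l _.
  move: (nat_of_ord j) (ltn_ord j) => {}j hj.
  have hlN : (Q - l <= N)%N by rewrite /N; lia.
  rewrite -mulrA [y ^+ j * _]mulrA (@var_pow_mul _ N) // mulr_suml mulr_sumr.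
  rewrite -(subnKC hlN) big_split_ord /= -addrA addrC -addrA.
  rewrite [X in _ + X](_ : _ = 0) ?addr0; last first.
    rewrite addrC; apply/eqP; rewrite subr_eq0; apply/eqP; apply: eq_bigr => t _.
    by rewrite addnK -!mulrA -exprD.
  apply: (ipow_sum hB hJ) => t _; rewrite -!mulrA -exprD mulrA.
  apply: (ipow_le hB hJ _ (Ipow_var_Jpow _ (ipow0 I _))); first by have := ltn_ord l; lia.
  by apply: (subringM hA) => //; apply: expandA.
apply: (ipow_trans hB hJ h1); apply: (ipow_trans hB hJ h3); exact: (ipowBC hB).
Qed.

(** Multiplying by one more factor from [J] gains one order in each term: from its constant
    coefficient, which is in [I], when [l = 0], and from its power of [y] when [l > 0]. *)
Lemma Jpow_coefs_ex K b : pJ K b -> exists2 r, coefs r b & forall l, pI (K - l) (r l).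
Proof.
have coef0 b' u : J b' -> coefs u b' -> I (u 0%N).
  move=> hb' hu; have hu1 := coefs_mod 1 hu; have [hA' _] := hu.
  apply: J_meet_A => //; rewrite -[u 0%N](subKr b').
  apply: (idealB hB hJ) => //; have := ipowS_ideal hB hJ hu1.
  by rewrite /series_partial big_ord1 expr0 mulr1.
elim=> {K b} [b hb|K a b ha [r hr hrp] hb|K a b _ [r hr hrp] _ [u hu hup]].
- have [r hr] := coefs_ex hb; exists r => // l; rewrite sub0n.
  by apply: ipow0; case: hr.
- have Bb := ideal_sub hJ hb.
  have [u hu] := coefs_ex Bb; have [p hp hpp] := coefs_mul (ipow_sub hB hJ ha) Bb hr hu.
  exists p => // m; pose N := (m + (K.+1 - m))%N.
  rewrite -[p m](subrK (prodcoef N r u m)); apply: (ipowD hA hI); first exact: hpp.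
  have [hrA _] := hr; have [huA _] := hu.
  apply: (ipow_sum hA hI) => j _; apply: (ipow_sum hA hI) => l _.
  case: (eqVneq (val l) 0%N) => hl.
    have h0 : pI 1 (u l) by rewrite [nat_of_ord l]hl; apply: (ideal_ipow1 hA); exact: coef0 hb hu.
    apply: (ipow_le hA hI _ (ipowM hA hI (hrp j) (expand_pow j (m - l) h0))).
    by move: hl => /= hl; lia.
  apply: (ipow_le hA hI _ (ipowM hA hI (hrp j) (expand_pow _ _ (ipow0 I (huA l))))).
  by move: hl (ltn_ord l) => /= hl hlm; lia.
- have hu' := coefsB (coefsMy 0 (subring0 hA)) hu.
  exists (fun l => r l - ((if l == 0%N then 0 else 0) - u l)).
    by have := coefsB hr hu'; rewrite mul0r sub0r opprK.
  by move=> l; rewrite if_same sub0r opprK; apply: (ipowD hA hI).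
Qed.

Lemma Jpow_coefsP K r b : B b -> coefs r b -> (pJ K b <-> forall l, pI (K - l) (r l)).
Proof.
move=> Bb hr; split.
  by move=> /Jpow_coefs_ex [u hu h] l; rewrite (coefs_uniq hr hu).
move=> h; rewrite -[b](subrK (series_partial r y K)); apply: (ipowD hB hJ).
  exact: coefs_mod.
apply: (ipow_sum hB hJ) => l _.
by apply: (ipow_le hB hJ _ (Ipow_var_Jpow l (h l))); lia.
Qed.
End Extension.
(** * Exponents *)

Section Exponents.
Local Open Scope nat_scope.
Implicit Types (a b c : seq nat) (n : nat).

(* An exponent lists the powers of the variables, the latest variable at the head. *)
Fixpoint lex_gt a b : bool :=
  match a, b with
  | i :: a', j :: b' => (j < i)%N || (i == j) && lex_gt a' b'
  | _, _ => false
  end.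

Definition ahead a b := (sumn a < sumn b)%N || (sumn a == sumn b) && lex_gt a b.

Fixpoint expadd a b : seq nat :=
  match a, b with i :: a', j :: b' => (i + j)%N :: expadd a' b' | _, _ => [::] end.

Lemma sumn_expadd a b : size a = size b -> sumn (expadd a b) = (sumn a + sumn b)%N.
Proof. by elim: a b => [|i a IH] [|j b] //= [/IH ->]; lia. Qed.

Lemma lex_gt_irr a : lex_gt a a = false.
Proof. by elim: a => //= i a ->; rewrite ltnn andbF. Qed.

Lemma lex_gt_trans a b c : lex_gt a b -> lex_gt b c -> lex_gt a c.
Proof.
elim: a b c => [|i a IH] [|j b] [|l c] //=.
move=> /orP [h|/andP [/eqP -> h]] /orP [h'|/andP [/eqP e h']].
- by rewrite (ltn_trans h' h).
- by rewrite -e h.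
- by rewrite h'.
- by rewrite e eqxx (IH b c h h') orbT.
Qed.

Lemma lex_gt_total a b : size a = size b -> [|| lex_gt a b, a == b | lex_gt b a].
Proof.
elim: a b => [|i a IH] [|j b] //= [/IH h].
by rewrite eqseq_cons; case: (ltngtP i j) => //=.
Qed.

Lemma ahead_irr a : ahead a a = false.
Proof. by rewrite /ahead ltnn lex_gt_irr andbF. Qed.

Lemma ahead_trans a b c : ahead a b -> ahead b c -> ahead a c.
Proof.
rewrite /ahead => /orP [h|/andP [/eqP -> h]] /orP [h'|/andP [/eqP e h']].
- by rewrite (ltn_trans h h').
- by rewrite -e h.
- by rewrite h'.
- by rewrite e eqxx (lex_gt_trans h h') orbT.
Qed.

Lemma ahead_total a b : size a = size b -> [|| ahead a b, a == b | ahead b a].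
Proof.
move=> /lex_gt_total; rewrite /ahead; case: (ltngtP (sumn a) (sumn b)) => //= _.
by rewrite orbT.
Qed.

Lemma ahead_le a b : ahead a b -> (sumn a <= sumn b)%N.
Proof. by rewrite /ahead => /orP [/ltnW|/andP [/eqP ->]]. Qed.

Fixpoint exps_below n K : seq (seq nat) :=
  if n is n'.+1 then [seq i :: a | i <- iota 0 K, a <- exps_below n' (K - i)]
  else if K is 0 then [::] else [:: [::]].

Lemma mem_exps_below n K a : (a \in exps_below n K) = (size a == n) && (sumn a < K)%N.
Proof.
elim: n K a => [|n IH] K a /=.
  by case: K => [|K]; case: a => //=; rewrite ?inE.
apply/allpairsPdep/idP.
  move=> [i [b [hi hb ->]]]; move: hi hb; rewrite mem_iota IH /= => hi /andP [/eqP -> hb].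
  by rewrite eqxx /=; lia.
case: a => [|i b] //=; rewrite eqSS => /andP [hs hK].
exists i, b; split=> //; first by rewrite mem_iota; lia.
by rewrite IH hs /=; lia.
Qed.

Lemma uniq_exps_below n K : uniq (exps_below n K).
Proof.
elim: n K => [|n IH] K /=; first by case: K.
by apply: allpairs_uniq_dep; [exact: iota_uniq|move=> *; exact: IH|move=> [i a] [j b] _ _ /= [-> ->]].
Qed.

Lemma size_exps_below n K : (size (exps_below n K) <= K ^ n)%N.
Proof.
elim: n K => [|n IH] K /=; first by case: K.
rewrite size_allpairs_dep sumnE big_map.
have: (\sum_(i <- iota 0 K) size (exps_below n (K - i)) <= \sum_(i <- iota 0 K) K ^ n)%N.
  apply: leq_sum => i _; apply: leq_trans (IH _) _.
  by case: n {IH} => [|n]; [rewrite !expn0|rewrite leq_exp2r // leq_subr].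
by rewrite big_const_seq count_predT size_iota iter_addn_0 expnS mulnC.
Qed.

Lemma count_lt (T : eqType) (p q : pred T) (s : seq T) x : x \in s ->
  (forall y, p y -> q y) -> q x -> ~~ p x -> (count p s < count q s)%N.
Proof.
move=> + hpq qx px; elim: s => // y s IH; rewrite inE => /orP [/eqP <-|/IH h] /=.
  by rewrite qx (negPf px) add0n add1n ltnS; apply: sub_count.
by case hy: (p y); [rewrite (hpq y hy)|case: (q y)]; lia.
Qed.

(** An exponent ahead of another has no larger total degree, so only finitely many are ahead of a
    given one; their number is the induction measure. *)
Lemma ahead_min n (P : seq nat -> Prop) :
  (exists2 a, size a = n & P a) ->
  exists a, [/\ size a = n, P a & forall b, size b = n -> ahead b a -> ~ P b].
Proof.
case=> a0 s0 P0; pose K := (sumn a0).+1.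
pose mu a := count (ahead^~ a) (exps_below n K).
have [m] := ubnP (mu a0); have : (sumn a0 < K)%N by [].
move: K @mu => K mu; clear -s0 P0; elim: m a0 s0 P0 => // m IH a s0 P0 hK hm.
case: (classic (exists b, [/\ size b = n, ahead b a & P b])) => [[b [sb hb Pb]]|h]; last first.
  by exists a; split=> // b sb hb Pb; apply: h; exists b.
have hbK : (sumn b < K)%N by apply: leq_ltn_trans (ahead_le hb) hK.
apply: (IH b) => //; apply: (@leq_trans (mu a)); last exact: hm.
apply: (@count_lt _ _ _ _ b); first by rewrite mem_exps_below sb eqxx.
- by move=> c /ahead_trans; apply.
- exact: hb.
- by rewrite ahead_irr.
Qed.

(* The exponent of [x i.+1] among [n] variables. *)
Definition unit_exp n i : seq nat := nseq (n - i.+1) 0%N ++ 1%N :: nseq i 0%N.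

Lemma size_unit_exp n i : (i < n)%N -> size (unit_exp n i) = n.
Proof. by rewrite /unit_exp size_cat /= !size_nseq; lia. Qed.

Lemma sumn_unit_exp n i : sumn (unit_exp n i) = 1%N.
Proof. by rewrite /unit_exp sumn_cat /= !sumn_nseq. Qed.

Lemma unit_expS n i : (i < n)%N -> unit_exp n.+1 i = 0%N :: unit_exp n i.
Proof. by move=> h; rewrite /unit_exp subSn. Qed.

Lemma unit_exp_last n : unit_exp n.+1 n = 1%N :: nseq n 0%N.
Proof. by rewrite /unit_exp subnn. Qed.

Lemma sumn0P n a : size a = n -> sumn a = 0%N -> a = nseq n 0%N.
Proof.
move=> <-; elim: a => //= i a IH h.
by rewrite -IH //; [congr (_ :: _); lia | lia].
Qed.

Lemma sumn1P n a : size a = n -> sumn a = 1%N -> exists2 i, (i < n)%N & a = unit_exp n i.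
Proof.
move=> <-; elim: a => //= i a IH h; case: i h => [/IH [j hj e]|[h|i]] //.
  by exists j; [exact: ltnW|rewrite unit_expS // -e].
by exists (size a) => //; rewrite unit_exp_last -(@sumn0P (size a) a) //; case: h.
Qed.

Lemma ahead_unit_exp n i l : (i < n)%N -> (l < n)%N -> ahead (unit_exp n i) (unit_exp n l) = (l < i)%N.
Proof.
rewrite /ahead !sumn_unit_exp ltnn eqxx /=.
elim: n => // n IH; rewrite ltnS leq_eqVlt => /orP [/eqP ->|hi];
  rewrite ltnS leq_eqVlt => /orP [/eqP ->|hl].
- by rewrite lex_gt_irr ltnn.
- by rewrite unit_exp_last unit_expS //= hl.
- by rewrite unit_exp_last unit_expS //= ltnNge ltnW.
- by rewrite !unit_expS //= IH.
Qed.

(** Induction on [n]: [G] covers the tails of [E], and each [g] in it has a witness [w g] for the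
    head. A head of at least [M] exceeds all witnesses; the finitely many smaller heads are treated
    slice by slice. *)
Lemma dickson n (E : seq nat -> Prop) :
  exists G : seq (seq nat), (forall g, g \in G -> size g = n /\ E g) /\
    forall a, size a = n -> E a -> exists2 g, g \in G & all2 leq g a.
Proof.
elim: n E => [|n IH] E.
  case: (classic (E [::])) => h.
    exists [:: [::]]; split; first by move=> g; rewrite inE => /eqP ->.
    by move=> [|//] _ _; exists [::]; rewrite ?inE.
  by exists [::]; split=> // - [|//].
have [G [hG1 hG2]] := IH (fun a => exists i, E (i :: a)).
have [w hw] : exists w : seq nat -> nat, forall g, g \in G -> E (w g :: g).
  have /fun_choice [w hw] : forall g, exists i, g \in G -> E (i :: g).
    move=> g; case hg: (g \in G); last by exists 0%N.
    by case: (hG1 g hg) => _ [i hi]; exists i.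
  by exists w.
have /fun_choice [H hH] := fun i => IH (fun a => E (i :: a)).
pose M := (\sum_(g <- G) w g)%N.
exists ([seq w g :: g | g <- G] ++ flatten [seq [seq i :: h | h <- H i] | i <- iota 0 M]).
split.
  move=> g; rewrite mem_cat => /orP [/mapP [h hh ->]|/flatten_mapP [i _ /mapP [h hh ->]]].
    by split; [case: (hG1 h hh) => /= ->|exact: hw].
  by case: (hH i) => hHi _; case: (hHi h hh) => /= ->.
case=> [//|i a] /= [sa] Ea.
have [g hg hga] := hG2 a sa (ex_intro _ i Ea).
case: (ltnP i M) => hi; last first.
  exists (w g :: g); first by rewrite mem_cat map_f.
  rewrite /= hga andbT; apply: leq_trans hi.
  by rewrite /M; elim: (G) hg => //= h s IHs; rewrite inE big_cons => /orP [/eqP ->|/IHs]; lia.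
have [_ /(_ a sa Ea) [h hh hha]] := hH i.
exists (i :: h); last by rewrite /= leqnn.
rewrite mem_cat; apply/orP; right; apply/flatten_mapP; exists i; first by rewrite mem_iota.
by apply: map_f.
Qed.

Lemma all2_leq_expadd a g : all2 leq g a -> exists2 b, size b = size g & a = expadd b g.
Proof.
elim: g a => [|j g IH] [|i a] //=; first by exists [::].
move=> /andP [hj /IH [b sb ->]]; exists ((i - j)%N :: b); first by rewrite /= sb.
by rewrite /= subnK.
Qed.

End Exponents.
(** * Coefficients and least exponents *)

Section Coords.
Variables (k : unitRingType) (R : nzRingType) (iota : {rmorphism k -> R}) (x : nat -> R).
Hypothesis kdiv : forall a : k, a != 0 -> a \is a GRing.unit.

(** The index of a variable is read off the length of the tail, so zeros put at the head, for later
    variables, do not change the monomial. *)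
Fixpoint mon (a : seq nat) : R :=
  if a is l :: b then mon b * x (size b).+1 ^+ l else 1.

Lemma mon_pad q a : mon (nseq q 0%N ++ a) = mon a.
Proof. by elim: q => //= q ->; rewrite expr0 mulr1. Qed.

Lemma mon0 n : mon (nseq n 0%N) = 1.
Proof. by rewrite -[nseq n 0%N]cats0 mon_pad. Qed.

Lemma mon_unit_exp n i : mon (unit_exp n i) = x i.+1.
Proof. by rewrite mon_pad /= mon0 mul1r size_nseq. Qed.

(* Leading means least for [ahead], as for power series. *)
Definition lead (n : nat) (cf : R -> seq nat -> k) f a :=
  [/\ size a = n, cf f a != 0 & forall b, size b = n -> ahead b a -> cf f b = 0].

(** The invariant carried up the tower. Values of [cf] are constrained only on [A] and on exponents
    of length [n]. The field [coP] reads the adic filtration off the coefficients, [co_surj] stands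
    in for completeness, and only [co_leadM] depends on the order of exponents. *)
Record coords n (A I : R -> Prop) (cf : R -> seq nat -> k) : Prop := Coords {
  co_iota : forall c, A (iota c);
  coB : forall f g a, A f -> A g -> size a = n -> cf (f - g) a = cf f a - cf g a;
  coZ : forall c f a, A f -> size a = n -> cf (iota c * f) a = c * cf f a;
  coP : forall K f, A f -> (ideal_pow A I K f <->
          forall a, size a = n -> (sumn a < K)%N -> cf f a = 0);
  co_surj : forall c : seq nat -> k, exists2 f, A f & forall a, size a = n -> cf f a = c a;
  co_monA : forall a, size a = n -> A (mon a);
  co_mon : forall a b, size a = n -> size b = n -> cf (mon a) b = (a == b)%:R;
  co_leadM : forall f g a b, A f -> A g -> lead n cf f a -> lead n cf g b ->
               lead n cf (f * g) (expadd a b) }.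

Section Theory.
Variables (n : nat) (A I : R -> Prop) (cf : R -> seq nat -> k).
Hypothesis H : coords n A I cf.
Hypothesis hA : subring A.
Hypothesis hI : ideal_of A I.
Hypothesis I1 : ~ I 1.
Local Notation pw := (ideal_pow A I).
Local Notation z0 := (nseq n 0%N).
Let sz0 : size z0 = n. Proof. exact: size_nseq. Qed.

Lemma co0 a : size a = n -> cf 0 a = 0.
Proof. by move=> sa; rewrite -(subrr 0) (coB H) ?subrr //; exact: (subring0 hA). Qed.
Lemma coN f a : A f -> size a = n -> cf (- f) a = - cf f a.
Proof. by move=> hf sa; rewrite -[- f]sub0r (coB H) ?co0 ?sub0r //; exact: (subring0 hA). Qed.
Lemma coD f g a : A f -> A g -> size a = n -> cf (f + g) a = cf f a + cf g a.
Proof. by move=> hf hg sa; rewrite -[g]opprK (coB H) ?coN //; exact: (subringN hA). Qed.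
Lemma co_sum (T : Type) (s : seq T) (P : pred T) (F : T -> R) a :
  (forall i, P i -> A (F i)) -> size a = n ->
  cf (\sum_(i <- s | P i) F i) a = \sum_(i <- s | P i) cf (F i) a.
Proof.
move=> hF sa; elim: s => [|i s IH]; first by rewrite !big_nil co0.
rewrite !big_cons; case: ifP => // Pi; rewrite coD ?IH //; first exact: hF.
exact: (subring_sum hA).
Qed.

Lemma co_pow K f a : pw K f -> size a = n -> (sumn a < K)%N -> cf f a = 0.
Proof. by move=> hf; move: a; apply/(coP H K (ipow_sub hA hI hf)). Qed.

Lemma co_I f : A f -> (I f <-> cf f z0 = 0).
Proof.
move=> hf; split.
  by move=> /(ideal_ipow1 hA) h; apply: co_pow h _ _ => //; rewrite sumn_nseq.
move=> h; apply: (ipowS_ideal hA hI (k := 0)); apply/(coP H) => // a sa ha.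
by rewrite (sumn0P sa) //; lia.
Qed.

Lemma co_term c a b : size a = n -> size b = n ->
  cf (iota c * mon a) b = if a == b then c else 0.
Proof.
move=> sa sb; rewrite (coZ H) ?(co_mon H) //; last exact: (co_monA H).
by case: eqP; rewrite ?mulr1 ?mulr0.
Qed.

Lemma co_iotaE c a : size a = n -> cf (iota c) a = if a == z0 then c else 0.
Proof.
by move=> sa; rewrite -[iota c]mulr1 -(mon0 n) co_term // eq_sym.
Qed.

Lemma co_res_sub f : A f -> I (f - iota (cf f z0)).
Proof.
move=> hf; have hi := co_iota H (cf f z0).
by apply/co_I; [exact: (subringB hA)|rewrite (coB H) // co_iotaE // eqxx subrr].
Qed.

(** Supplies the hypothesis [hres] of the next extension: a non-zero constant term is a unit of
    [k]. *)
Lemma co_res f : A f -> I f \/ exists2 g, A g & I (g * f - 1).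
Proof.
move=> hf; have h := co_res_sub hf.
case: (eqVneq (cf f z0) 0) => [/co_I e|e]; first by left; apply: e.
right; exists (iota (cf f z0)^-1); first exact: (co_iota H).
have -> : 1 = iota (cf f z0)^-1 * iota (cf f z0) by rewrite -rmorphM mulVr ?rmorph1 ?kdiv.
by rewrite -mulrBr; apply: (idealMl hI) => //; exact: (co_iota H).
Qed.

Lemma co_approx K f : A f ->
  pw K (f - \sum_(a <- exps_below n K) iota (cf f a) * mon a).
Proof.
move=> hf.
have hF a : (a \in exps_below n K) -> A (iota (cf f a) * mon a).
  rewrite mem_exps_below => /andP [/eqP sa _].
  by apply: (subringM hA); [exact: (co_iota H)|exact: (co_monA H)].
rewrite big_seq.
have hS := @subring_sum _ _ hA _ (exps_below n K) _ _ hF.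
apply/(coP H); first exact: (subringB hA).
move=> b sb hb; rewrite (coB H) // co_sum //.
have hbK : b \in exps_below n K by rewrite mem_exps_below sb eqxx.
rewrite -big_seq (bigD1_seq b) ?uniq_exps_below //= co_term // eqxx.
rewrite big_seq_cond big1 ?addr0 ?subrr // => a /andP [].
rewrite mem_exps_below => /andP [/eqP sa _] ne.
by rewrite co_term // (negPf ne).
Qed.

Lemma lead_ex f : (exists2 a, size a = n & cf f a != 0) -> exists a, lead n cf f a.
Proof.
move=> /ahead_min [a [sa ha hmin]]; exists a; split=> // b sb hb.
by apply/eqP; apply: NNPP => /negP; exact: hmin.
Qed.

Lemma lead_z0 f : cf f z0 != 0 -> lead n cf f z0.
Proof.
move=> h; split=> // b sb hb; have := ahead_le hb.
rewrite sumn_nseq => hb0; move: hb; rewrite (sumn0P sb) ?ahead_irr //; lia.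
Qed.

(** * Automorphisms preserving least exponents *)

Section Automorphism.
Variable s : R -> R.
Hypothesis hs : ring_automorphism_of A s.
Hypothesis sI : forall a, I a -> I (s a).
Hypothesis s_ue : forall i a, (i < n)%N -> size a = n -> ahead a (unit_exp n i) ->
  cf (s (mon (unit_exp n i))) a = 0.

Let sA a : A a -> A (s a). Proof. by case: hs => h _; apply: h. Qed.
Let sD a b : A a -> A b -> s (a + b) = s a + s b.
Proof. by case: hs => _ [h _]; apply: h. Qed.
Let sM a b : A a -> A b -> s (a * b) = s a * s b.
Proof. by case: hs => _ [_ [h _]]; apply: h. Qed.
Let s1 : s 1 = 1. Proof. by case: hs => _ [_ [_ []]]. Qed.
Let s_inj a b : A a -> A b -> s a = s b -> a = b.
Proof. by case: hs => _ [_ [_ [_ [h _]]]]; apply: h. Qed.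
Let s_onto b : A b -> exists2 a, A a & s a = b.
Proof. by case: hs => _ [_ [_ [_ [_ h]]]]; apply: h. Qed.
Let sB a b : A a -> A b -> s (a - b) = s a - s b.
Proof.
move=> ha hb; apply/eqP; rewrite -subr_eq0 opprB addrA -sD ?subrK ?subrr //.
exact: (subringB hA).
Qed.
Let s0 : s 0 = 0.
Proof. by rewrite -(subrr 1) sB ?subrr //; exact: (subring1 hA). Qed.
Let s_sum (T : Type) (r : seq T) (P : pred T) (F : T -> R) :
  (forall i, P i -> A (F i)) ->
  s (\sum_(i <- r | P i) F i) = \sum_(i <- r | P i) s (F i).
Proof.
move=> hF; elim: r => [|i r IH]; first by rewrite !big_nil.
rewrite !big_cons; case: ifP => // Pi; rewrite sD ?IH //; first exact: hF.
exact: (subring_sum hA).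
Qed.

Lemma autI_inv b : A b -> I (s b) -> I b.
Proof.
move=> hb hsb; case: (co_res hb) => // [[c hc /sI h]]; case: I1.
rewrite -[1](subKr (s c * s b)); apply: (idealB hA hI); first by apply: (idealMl hI) => //; exact: sA.
by move: h; rewrite sB ?sM ?s1 //; [exact: (subringM hA)|exact: (subring1 hA)].
Qed.

Lemma aut_pow K a : pw K a -> pw K (s a).
Proof.
elim=> {K a} [a ha|K a b ha IH hb|K a b ha IHa hb IHb].
- by apply: ipow0; apply: sA.
- rewrite sM; [|exact: ipow_sub ha|exact: (ideal_sub hI)].
  by apply: ipow_mul => //; apply: sI.
- by rewrite sD; [apply: ipow_add|exact: ipow_sub ha|exact: ipow_sub hb].
Qed.

(** By [autI_inv] the preimages of elements of [I] lie in [I], so a sum of products in [I^K] lifts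
    through [s] factor by factor; injectivity identifies the lift with [b]. *)
Lemma aut_pow_inv K b : A b -> pw K (s b) -> pw K b.
Proof.
move=> hb hsb.
suff [c hc e] : exists2 c, pw K c & s c = s b.
  by rewrite -(s_inj (ipow_sub hA hI hc) hb e).
elim: {b hb} hsb => {K} [a ha|K a b _ [a' ha' <-] hb|K a b _ [a' ha' <-] _ [b' hb' <-]].
- by have [a' ha' <-] := s_onto ha; exists a' => //; apply: ipow0.
- have [b' hb' e] := s_onto (ideal_sub hI hb).
  exists (a' * b'); last by rewrite sM ?e //; exact: ipow_sub ha'.
  by apply: ipow_mul => //; apply: autI_inv => //; rewrite e.
- exists (a' + b'); first exact: ipow_add.
  by rewrite sD //; [exact: ipow_sub ha'|exact: ipow_sub hb'].
Qed.

(* [s] acts on the [k]-space [I / I^2], spanned by the variables, preserving the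
   flag spanned by the first variables; its diagonal entries cannot vanish. *)
Lemma aut_unit_exp i : (i < n)%N -> cf (s (mon (unit_exp n i))) (unit_exp n i) != 0.
Proof.
have monA l : (l < n)%N -> A (mon (unit_exp n l)) by move=> hl; apply: (co_monA H); exact: size_unit_exp.
have uI l : (l < n)%N -> pw 1 (mon (unit_exp n l)).
  move=> hl; apply/(coP H); first exact: monA.
  move=> a sa ha; rewrite (co_mon H) ?size_unit_exp //; case: eqP => // e.
  by move: ha; rewrite -e sumn_unit_exp.
have supp l b : (l < n)%N -> size b = n -> (sumn b <= 1)%N ->
    cf (s (mon (unit_exp n l))) b != 0 -> exists2 u, (u <= l)%N & b = unit_exp n u.
  move=> hl sb hb1 hb; have [e|e] : sumn b = 0%N \/ sumn b = 1%N by lia.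
    by move: hb; rewrite s_ue ?eqxx // /ahead e sumn_unit_exp.
  have [u hu eu] := sumn1P sb e; exists u => //; rewrite leqNgt; apply/negP => hlu.
  by move: hb; rewrite s_ue ?eqxx // eu ahead_unit_exp.
have ue_inj l u : (l < n)%N -> (u < n)%N -> unit_exp n l = unit_exp n u -> l = u.
  move=> hl hu e; have := ahead_unit_exp hl hu; have := ahead_unit_exp hu hl.
  by rewrite e ahead_irr; case: ltngtP.
elim/ltn_ind: i => i IH hi; apply/negP => /eqP h0.
(* Elimination: if the diagonal entry at [i] vanished, the linear terms of the image could be
   removed one by one with the earlier variables, whose diagonal entries are non-zero by induction.
   At [q = i] the image lies in [I^2] although [w] does not. *)
have key q : (q <= i)%N -> exists w, [/\ A w, cf w (unit_exp n i) = 1 &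
    forall b, size b = n -> (sumn b <= 1)%N -> cf (s w) b != 0 ->
      exists2 u, (u < i - q)%N & b = unit_exp n u].
  elim: q => [_|q IHq hq].
    exists (mon (unit_exp n i)); split; first exact: monA.
      by rewrite (co_mon H) ?size_unit_exp // eqxx.
    move=> b sb hb1 hb; have [u hu e] := supp i b hi sb hb1 hb; exists u => //.
    rewrite subn0 ltn_neqAle hu andbT; apply/eqP => eu.
    by move: hb; rewrite e eu h0 eqxx.
  have [w [hw hw1 hw2]] := IHq (ltnW hq).
  pose t := (i - q.+1)%N; have hti : (t < i)%N by rewrite /t; lia.
  have htn : (t < n)%N := ltn_trans hti hi.
  have et : (i - q)%N = t.+1 by rewrite /t; lia.
  have ne := IH t hti htn.
  set e := cf (s (mon (unit_exp n t))) (unit_exp n t) in ne.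
  pose c := cf (s w) (unit_exp n t) / e.
  (* The multiplier must map to the scalar [c]. It need not be a scalar itself, but its part in [I]
     only contributes in degree two. *)
  have [b hb eb] := s_onto (co_iota H c).
  have hbx : A (b * mon (unit_exp n t)) by apply: (subringM hA) => //; exact: monA.
  exists (w - b * mon (unit_exp n t)); split; first exact: (subringB hA).
    rewrite (coB H) ?size_unit_exp // hw1 -[b](subrK (iota (cf b z0))) mulrDl.
    have hz := ideal_ipow1 hA (co_res_sub hb).
    rewrite coD ?size_unit_exp //; last 2 first.
    - by apply: (subringM hA); [exact: (ipow_sub hA hI hz)|exact: monA].
    - by apply: (subringM hA); [exact: (co_iota H)|exact: monA].
    rewrite (co_pow (ipowM hA hI hz (uI t htn))) ?size_unit_exp ?sumn_unit_exp //.
    rewrite co_term ?size_unit_exp //.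
    case: eqP => [/(ue_inj _ _ htn hi) et'|]; first by move: hti; rewrite et' ltnn.
    by rewrite addr0 subr0.
  have hsb b' : size b' = n -> cf (s (w - b * mon (unit_exp n t))) b' =
      cf (s w) b' - c * cf (s (mon (unit_exp n t))) b'.
    have hsx : A (s (mon (unit_exp n t))) by apply: sA; exact: monA.
    move=> sb'; rewrite sB // sM ?eb //; last exact: monA.
    rewrite (coB H) ?(coZ H) //; first exact: sA.
    by apply: (subringM hA) => //; exact: (co_iota H).
  move=> b' sb' hb1; rewrite hsb //; case: (eqVneq b' (unit_exp n t)) => [->|net].
    by rewrite -/e /c divrK ?kdiv // subrr eqxx.
  case: (eqVneq (cf (s w) b') 0) => [->|hne].
    rewrite sub0r oppr_eq0 => hne; have: cf (s (mon (unit_exp n t))) b' != 0.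
      by apply: contraNneq hne => ->; rewrite mulr0.
    case/(supp t b' htn sb' hb1) => u hu eu; exists u => //.
    by rewrite ltn_neqAle hu andbT; apply: contraNneq net => eut; apply/eqP; rewrite eu eut.
  move=> _; have [u hu eu] := hw2 b' sb' hb1 hne; exists u => //.
  rewrite et ltnS in hu; rewrite ltn_neqAle hu andbT.
  by apply: contraNneq net => eut; apply/eqP; rewrite eu eut.
have [w [hw hw1 hw2]] := key i (leqnn i).
have : pw 2 w.
  apply: aut_pow_inv => //; apply/(coP H); first exact: sA.
  move=> b sb hb; apply/eqP; apply: NNPP => /negP hne.
  by have [u] := hw2 b sb hb hne; rewrite subnn.
move=> /co_pow h; move: hw1; rewrite h ?size_unit_exp ?sumn_unit_exp //.
by move/eqP; rewrite eq_sym oner_eq0.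
Qed.

Lemma expadd_pad q a b : expadd (nseq q 0%N ++ a) (nseq q 0%N ++ b) = nseq q 0%N ++ expadd a b.
Proof. by elim: q => //= q ->. Qed.
Lemma expadd0 q a : size a = q -> expadd a (nseq q 0%N) = a.
Proof. by move=> <-; elim: a => //= i a ->; rewrite addn0. Qed.
Lemma expadd0l q a : size a = q -> expadd (nseq q 0%N) a = a.
Proof. by move=> <-; elim: a => //= i a ->. Qed.

(** The padding by [q] zeros lets the induction run over the tails of an exponent while staying
    inside the level [n]. *)
Lemma aut_lead_mon q a : (q + size a = n)%N ->
  lead n cf (s (mon a)) (nseq q 0%N ++ a).
Proof.
elim: a q => [|l a IH] q /=.
  rewrite addn0 cats0 s1 => ->; apply: lead_z0.
  by rewrite -(rmorph1 iota) co_iotaE // eqxx oner_eq0.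
move=> hq; have hi : (size a < n)%N by lia.
have hxu : x (size a).+1 = mon (unit_exp n (size a)) by rewrite mon_unit_exp.
have hx : A (x (size a).+1) by rewrite hxu; apply: (co_monA H); exact: size_unit_exp.
have hma : A (mon a).
  by rewrite -(mon_pad q.+1); apply: (co_monA H); rewrite size_cat size_nseq addSnnS.
have hxl m : lead n cf (s (x (size a).+1 ^+ m)) (nseq q 0%N ++ m :: nseq (size a) 0%N).
  elim: m => [|m IHm].
    rewrite expr0 s1 -[0%N :: _]/(nseq (size a).+1 0%N) -nseqD hq; apply: lead_z0.
    by rewrite -(rmorph1 iota) co_iotaE // eqxx oner_eq0.
  have -> : nseq q 0%N ++ m.+1 :: nseq (size a) 0%N =
    expadd (unit_exp n (size a)) (nseq q 0%N ++ m :: nseq (size a) 0%N).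
    rewrite /unit_exp (_ : n - (size a).+1 = q)%N; last by lia.
    by rewrite expadd_pad /= add1n expadd0 // size_nseq.
  rewrite exprS sM //; last exact: (subringX hA).
  apply: (co_leadM H) => //; try apply: sA => //; first exact: (subringX hA).
  rewrite hxu; split; [exact: size_unit_exp|exact: aut_unit_exp|move=> b sb hb; exact: s_ue].
have -> : nseq q 0%N ++ l :: a = expadd (nseq q.+1 0%N ++ a) (nseq q 0%N ++ l :: nseq (size a) 0%N).
  have -> : nseq q.+1 0%N ++ a = nseq q 0%N ++ 0%N :: a by rewrite -addn1 nseqD -catA.
  by rewrite expadd_pad /= add0n expadd0.
rewrite sM //; last exact: (subringX hA).
by apply: (co_leadM H); [exact: sA|apply: sA; exact: (subringX hA)|apply: IH; lia|exact: hxl].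
Qed.

(** Since [s] preserves the powers of [I], [f] may be cut off beyond the degree of [a]. Each
    remaining term keeps its exponent as least one, so at [a] and ahead of it only the term of
    exponent [a] can contribute. *)
Lemma aut_lead f a : A f -> lead n cf f a -> lead n cf (s f) a.
Proof.
move=> hf [sa ha hmin].
pose K := (sumn a).+1.
have term_lead c b : c != 0 -> size b = n -> lead n cf (s (iota c * mon b)) b.
  move=> hc sb; rewrite sM; [|exact: (co_iota H)|exact: (co_monA H)].
  rewrite -[b in lead _ _ _ b](expadd0l sb); apply: (co_leadM H).
  - by apply: sA; exact: (co_iota H).
  - by apply: sA; exact: (co_monA H).
  - apply: lead_z0; apply/negP => /eqP/co_I h.
    have /co_I := autI_inv (co_iota H c) (h (sA (co_iota H c))).
    by move=> /(_ (co_iota H c)); rewrite co_iotaE // eqxx => /eqP; apply/negP.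
  - by have := @aut_lead_mon 0 b sb.
have hap := co_approx K hf.
have hF b : b \in exps_below n K -> A (iota (cf f b) * mon b).
  rewrite mem_exps_below => /andP [/eqP sb _].
  by apply: (subringM hA); [exact: (co_iota H)|exact: (co_monA H)].
rewrite big_seq in hap.
have hS := @subring_sum _ _ hA _ (exps_below n K) _ _ hF.
have hcf c : size c = n -> (sumn c < K)%N ->
    cf (s f) c = \sum_(b <- exps_below n K) cf (s (iota (cf f b) * mon b)) c.
  move=> sc hc; have := co_pow (aut_pow hap) sc hc.
  have [hsf hsS] := (sA hf, sA hS); rewrite sB // (coB H) // => /eqP; rewrite subr_eq0 => /eqP ->.
  by rewrite s_sum // co_sum // ?[RHS]big_seq // => b hb; apply: sA; exact: hF.
have hz b c : b \in exps_below n K -> size c = n -> (c == a) || ahead c a ->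
    (b == a) && (c == a) = false -> cf (s (iota (cf f b) * mon b)) c = 0.
  rewrite mem_exps_below => /andP [/eqP sb _] sc hca hne.
  case: (eqVneq (cf f b) 0) => [->|hb].
    by rewrite rmorph0 mul0r s0 co0.
  have [_ _ h] := term_lead _ _ hb sb; apply: h => //.
  have : ~~ ahead b a by apply/negP => /(hmin b sb)/eqP; apply/negP.
  have := @ahead_total b a; rewrite sb sa => /(_ erefl).
  case: (ahead b a) => //=; case: (eqVneq b a) hne => [->|_] //=; last first.
    by move=> _ hab _; case/orP: hca => [/eqP ->//|hca]; exact: ahead_trans hca hab.
  by move=> hne _ _; move: hca; rewrite hne.
split=> //.
- have haK : a \in exps_below n K by rewrite mem_exps_below sa eqxx ltnSn.
  rewrite hcf // (bigD1_seq a) ?uniq_exps_below //= big_seq_cond big1 ?addr0.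
    by case: (term_lead _ _ ha sa).
  by move=> b /andP [hb hba]; apply: hz => //; rewrite ?eqxx // (negPf hba).
- move=> c sc hca; rewrite hcf //; last by rewrite ltnS; exact: ahead_le.
  rewrite big_seq big1 // => b hb; apply: hz => //; rewrite ?hca ?orbT //.
  by case: (eqVneq c a) hca => [->|]; rewrite ?ahead_irr ?andbF.
Qed.

End Automorphism.
End Theory.
End Coords.

(** * Coordinates on a skew power series extension *)

Section LevelStep.
Variables (k : unitRingType) (R : nzRingType) (iota : {rmorphism k -> R}) (x : nat -> R).
Variables (n : nat) (A I B J : R -> Prop) (s d : R -> R) (cf : R -> seq nat -> k).
Local Notation y := (x n.+1).
Hypothesis hcA : complete_local_ring_of A I.
Hypothesis hcB : complete_local_ring_of B J.
Hypothesis hE : skew_power_series_ext A I B J s d y.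
Hypothesis hres : forall a, A a -> I a \/ exists2 b, A b & I (b * a - 1).
Hypothesis H : coords iota x n A I cf.
Hypothesis s_lead : forall f a, A f -> lead n cf f a -> lead n cf (s f) a.
Local Notation pI := (ideal_pow A I).
Local Notation pJ := (ideal_pow B J).
Local Notation coefs := (coefs A B J y).

Let hA : subring A. Proof. by case: hcA => [[]]. Qed.
Let hB : subring B. Proof. by case: hcB => [[]]. Qed.
Let hI : ideal_of A I. Proof. by case: hcA => [[_ [[]]]]. Qed.
Let AB : subset_of A B. Proof. by case: hE => _ []. Qed.
Let By : B y. Proof. by case: hE => _ [_ [_ [_ []]]]. Qed.
Let sA a : A a -> A (s a).
Proof. by case: hE => _ [_ [_ [[[[h _] _] _] _]]]; apply: h. Qed.

Variable r : R -> nat -> R.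
Hypothesis hr : forall b, B b -> coefs (r b) b.

Let rA b j : B b -> A (r b j). Proof. by move=> /hr []. Qed.

Definition next_coef (b : R) (a : seq nat) : k := if a is l :: a' then cf (r b l) a' else 0.

Lemma next_coef_pow K f : B f -> (pJ K f <-> forall a, size a = n.+1 -> (sumn a < K)%N -> next_coef f a = 0).
Proof.
move=> hf; have h := Jpow_coefsP hcA hcB hE hres K hf (hr hf); split.
  move=> /h hp [//|l a] /= [sa] hla.
  by apply: (co_pow H hA hI (hp l) sa); lia.
move=> hz; apply/h => l; apply/(coP H); first exact: rA.
by move=> a sa ha; apply: (hz (l :: a)) => /=; [rewrite sa|lia].
Qed.

Lemma next_coef_low f l a : A f -> size a = n -> next_coef f (l :: a) = if l == 0%N then cf f a else 0.
Proof.
move=> hf sa; have h := coefsMy hcA hcB hE 0 hf; rewrite expr0 mulr1 in h.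
rewrite /= (coefs_uniq hE (hr (AB hf)) h).
by case: eqP => // _; rewrite (co0 H).
Qed.

Let iterA j a : A a -> A (iter j s a).
Proof. by move=> ha; elim: j => //= j; exact: sA. Qed.
Let iter_lead j f a : A f -> lead n cf f a -> lead n cf (iter j s f) a.
Proof.
move=> hf hl; elim: j => // j IH; rewrite iterS; apply: s_lead => //.
exact: iterA.
Qed.

Section LeadCoefs.
Variables (f : R) (j0 : nat) (a0 : seq nat).
Hypothesis hf : B f.
Hypothesis hl : lead n.+1 next_coef f (j0 :: a0).

Lemma lead_coef_pow j : pI (j0 + sumn a0 - j) (r f j).
Proof.
case: hl => sa _ hm; apply/(coP H); first exact: rA.
move=> a ha hs; apply: (hm (j :: a)); rewrite /= ?ha //.
by rewrite /ahead /=; apply/orP; left; lia.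
Qed.

(** Above the power [j0] of [y] even a tie in total degree would come ahead of the leading exponent;
    hence one more order than in [lead_coef_pow]. *)
Lemma lead_coef_powS j : (j0 < j)%N -> pI ((j0 + sumn a0).+1 - j) (r f j).
Proof.
move=> hj; case: hl => sa _ hm; apply/(coP H); first exact: rA.
move=> a ha hs; apply: (hm (j :: a)); rewrite /= ?ha //.
by rewrite /ahead /= hj orTb andbT orbC -leq_eqVlt; lia.
Qed.

Lemma lead_coef : lead n cf (r f j0) a0.
Proof.
case: hl => [[sa] h hm]; split=> // b sb hb; apply: (hm (j0 :: b)); first by rewrite /= sb.
move: hb; rewrite /ahead /= ltnn eqxx ltn_add2l eqn_add2l => /orP [->|] //.
Qed.
End LeadCoefs.

(* In [r_j y^j * u_l y^l] only the pair of leading terms can reach the exponent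
   [j0 + l0 :: _] in degree [D]: any [delta] met while moving [y^j] across [u_l] costs a power
   of [y] and raises the order of the coefficient. *)
Lemma next_coef_leadM f g a b : B f -> B g -> lead n.+1 next_coef f a -> lead n.+1 next_coef g b ->
  lead n.+1 next_coef (f * g) (expadd a b).
Proof.
move=> hf hg; case: a => [|j0 a0]; first by case.
case: b => [|l0 b0]; first by move=> _ [].
move=> hla hlb.
have hfg : B (f * g) by apply: (subringM hB).
have [p hp hpp] := coefs_mul hcA hcB hE hf hg (hr hf) (hr hg).
have hpA m : A (p m) by case: hp.
have ep m : r (f * g) m = p m by rewrite (coefs_uniq hE (hr hfg) hp).
pose D := (j0 + sumn a0 + (l0 + sumn b0))%N.
pose tm m j l := r f j * expand s d j (m - l) (r g l).
have tA m j l : A (tm m j l).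
  by apply: (subringM hA); [exact: rA|apply: (expandA hcA hE); exact: rA].
have powD1 m j l : (l <= m)%N -> pI (D - m) (tm m j l).
  move=> hlm; apply: (ipow_le hA hI _ (ipowM hA hI (lead_coef_pow hf hla j)
     (expand_pow hcA hE j (m - l) (lead_coef_pow hg hlb l)))).
  by rewrite /D; lia.
(* If [j < m - l] the term is zero; if [j > j0] or [l > l0] it gains one order. Otherwise
   [m <= j + l <= j0 + l0 <= m] leaves only the excluded triple. *)
have powD2 m j l : (l <= m)%N -> (j0 + l0 <= m)%N ->
    ~~ [&& m == (j0 + l0)%N, j == j0 & l == l0] -> pI (D.+1 - m) (tm m j l).
  move=> hlm hm ne; case: (ltnP j (m - l)) => hj.
    by rewrite /tm (expand_gt hcA hE) // mulr0; exact: (ipow_zero hA hI).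
  case: (ltnP j0 j) => hj0.
    apply: (ipow_le hA hI _ (ipowM hA hI (lead_coef_powS hf hla hj0)
      (expand_pow hcA hE j (m - l) (lead_coef_pow hg hlb l)))).
    by rewrite /D; lia.
  case: (ltnP l0 l) => hl0.
    apply: (ipow_le hA hI _ (ipowM hA hI (lead_coef_pow hf hla j)
      (expand_pow hcA hE j (m - l) (lead_coef_powS hg hlb hl0)))).
    by rewrite /D; lia.
  by case/negP: ne; apply/and3P; split; lia.
have sz0 : size a0 = n by case: hla => [[]].
have szb0 : size b0 = n by case: hlb => [[]].
have sum_e : sumn (expadd a0 b0) = (sumn a0 + sumn b0)%N by rewrite sumn_expadd ?sz0.
(* The range of [j] is long enough both for the truncation to be exact at [c] and for the main term
   [j0] to occur in it. *)
have cf_p m c : size c = n ->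
    cf (p m) c = \sum_(j < m + (sumn c + j0).+1) \sum_(l < m.+1) cf (tm m j l) c.
  move=> sc; set N := (m + _)%N.
  have hN : (m + (sumn c).+1 <= N)%N by rewrite /N; lia.
  have hcA' : A (prodcoef s d N (r f) (r g) m).
    by apply: (prodcoefA hcA hE) => j; exact: rA.
  have := co_pow H hA hI (hpp _ _ _ hN) sc (ltnSn _).
  rewrite (coB H) // => /eqP; rewrite subr_eq0 => /eqP ->.
  rewrite /prodcoef (co_sum H hA) // => [|j _]; last first.
    by apply: (subring_sum hA) => l _; exact: tA.
  by apply: eq_bigr => j _; rewrite (co_sum H hA) // => l _; exact: tA.
have lt_zero m c : size c = n -> (m + sumn c < D)%N -> cf (p m) c = 0.
  move=> sc hmc; rewrite cf_p // big1 // => j _; rewrite big1 // => l _.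
  by apply: (co_pow H hA hI (powD1 m j l _) sc); [have := ltn_ord l; lia|lia].
have gt_zero m c : size c = n -> (m + sumn c <= D)%N -> (j0 + l0 < m)%N -> cf (p m) c = 0.
  move=> sc hmc hm; rewrite cf_p // big1 // => j _; rewrite big1 // => l _.
  have h : pI (D.+1 - m) (tm m j l).
    by apply: powD2; [have := ltn_ord l; lia|lia|apply/negP => /and3P [/eqP]; lia].
  by apply: (co_pow H hA hI h sc); lia.
have eq_main c : size c = n -> (j0 + l0 + sumn c <= D)%N ->
    cf (p (j0 + l0)%N) c = cf (r f j0 * iter j0 s (r g l0)) c.
  move=> sc hc; set m := (j0 + l0)%N; rewrite cf_p //.
  have hj0 : (j0 < m + (sumn c + j0).+1)%N by rewrite /m; lia.
  have hl0 : (l0 < m.+1)%N by rewrite /m; lia.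
  have ez (j l : nat) : (l < m.+1)%N -> ~~ ((j == j0) && (l == l0)) -> cf (tm m j l) c = 0.
    move=> hlm hne; have h : pI (D.+1 - m) (tm m j l) by apply: powD2; rewrite ?eqxx.
    by apply: (co_pow H hA hI h sc); rewrite /m; lia.
  rewrite (bigD1 (Ordinal hj0)) //= (bigD1 (Ordinal hl0)) //= big1 ?addr0; last first.
    move=> l hl; apply: ez => //=; rewrite eqxx /=.
    by apply: contraNneq hl => e; apply/eqP/val_inj.
  rewrite big1 ?addr0; last first.
    move=> j hj; apply: big1 => l _; apply: ez => //; rewrite negb_and; apply/orP; left.
    by apply: contraNneq hj => e; apply/eqP/val_inj.
  by rewrite /tm /m addnK (expand_diag hcA hE).
have [sM hM hmin] := co_leadM H (rA j0 hf) (iterA j0 (rA l0 hg))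
  (lead_coef hla) (iter_lead j0 (rA l0 hg) (lead_coef hlb)).
have De : (j0 + l0 + sumn (expadd a0 b0))%N = D by rewrite sum_e /D; lia.
split=> /=.
- by rewrite sM.
- by rewrite ep eq_main // De.
- case=> [//|m c] [sc] hc /=; rewrite ep.
  move: hc; rewrite /ahead /= De => /orP [hc|/andP [/eqP hc]].
    exact: lt_zero.
  move=> /orP [hm|/andP [/eqP em hlex]]; first by apply: gt_zero => //; lia.
  subst m; rewrite eq_main //; last by lia.
  by apply: hmin => //; rewrite /ahead hlex (_ : sumn c = sumn (expadd a0 b0)) ?eqxx ?orbT //; lia.
Qed.

Lemma coords_step : coords iota x n.+1 B J next_coef.
Proof.
split.
- by move=> c; apply: AB; exact: (co_iota H).
- move=> f g [//|l a] hf hg [sa] /=.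
  have e := coefs_uniq hE (hr (subringB hB hf hg)) (coefsB hcA hcB hE (hr hf) (hr hg)).
  by rewrite e (coB H) //; exact: rA.
- move=> c f [//|l a] hf [sa] /=.
  have hc : B (iota c) by apply: AB; exact: (co_iota H).
  have e := coefs_uniq hE (hr (subringM hB hc hf)) (coefsMl hcA hcB hE (co_iota H c) (hr hf)).
  by rewrite e (coZ H) //; exact: rA.
- exact: next_coef_pow.
- move=> c; have /fun_choice [u hu] : forall l, exists f, A f /\ forall a, size a = n -> cf f a = c (l :: a).
    by move=> l; have [f hf h] := co_surj H (fun a => c (l :: a)); exists f.
  have [b hb hub] := coefs_series hE (fun l => proj1 (hu l)).
  exists b => // - [//|l a] [sa] /=.
  by rewrite (coefs_uniq hE (hr hb) hub); case: (hu l) => _ ->.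
- move=> [//|l a] [sa] /=; apply: (subringM hB); first by apply: AB; exact: (co_monA H).
  by apply: (subringX hB); rewrite sa.
- move=> [//|l a] [//|m b] [sa] [sb] /=.
  have hm : A (mon x a) by exact: (co_monA H).
  have hB' : B (mon x a * x (size a).+1 ^+ l).
    by apply: (subringM hB); [exact: AB|apply: (subringX hB); rewrite sa].
  have hco := coefsMy hcA hcB hE l hm; rewrite -sa in hco *.
  rewrite (coefs_uniq hE (hr hB') _ : _ =1 (fun j => if j == l then mon x a else 0)); last first.
    by rewrite sa in hco *.
  rewrite eqseq_cons [l == m]eq_sym; case: eqP => _ /=; first by rewrite (co_mon H).
  by rewrite (co0 H).
- exact: next_coef_leadM.
Qed.

End LevelStep.

(** * Right ideals generated by a subset *)

Inductive rspan (R : nzRingType) (I : R -> Prop) : R -> Prop :=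
| rspan0 : rspan I 0
| rspan_add a r g : I a -> rspan I g -> rspan I (a * r + g).

Section RightSpan.
Variables (R : nzRingType) (I : R -> Prop).

Lemma rspanD f g : rspan I f -> rspan I g -> rspan I (f + g).
Proof.
move=> hf hg; elim: hf => [|a r f' ha _ IH]; first by rewrite add0r.
by rewrite -addrA; apply: rspan_add.
Qed.

Lemma rspanMr f r : rspan I f -> rspan I (f * r).
Proof.
elim=> [|a r' f' ha _ IH]; first by rewrite mul0r; exact: rspan0.
by rewrite mulrDl -mulrA; apply: rspan_add.
Qed.

Lemma rspan_gen a r : I a -> rspan I (a * r).
Proof. by move=> ha; rewrite -[a * r]addr0; apply: rspan_add => //; exact: rspan0. Qed.

Lemma rspan_sum (T : eqType) (s : seq T) (F : T -> R) :
  (forall i, i \in s -> rspan I (F i)) -> rspan I (\sum_(i <- s) F i).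
Proof.
move=> h; rewrite big_seq; apply: big_ind => //; [exact: rspan0|exact: rspanD].
Qed.
End RightSpan.

(** * The tower and the lower bound *)

Section Tower.
Variables (k : unitRingType) (R : nzRingType) (iota : {rmorphism k -> R}) (n : nat).
Hypothesis kdiv : forall a : k, a != 0 -> a \is a GRing.unit.
Hypothesis iota_inj : injective iota.
Variables (Rs m : nat -> R -> Prop) (sigma delta : nat -> R -> R) (x : nat -> R).
Hypothesis Rs0 : forall r, Rs 0%N r <-> exists a, r = iota a.
Hypothesis Rsn : forall r, Rs n r.
Hypothesis hc : forall i, (i <= n)%N -> complete_local_ring_of (Rs i) (m i).
Hypothesis hE : forall i, (i < n)%N ->
  skew_power_series_ext (Rs i) (m i) (Rs i.+1) (m i.+1) (sigma i.+1) (delta i.+1) (x i.+1).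
Hypothesis stable : forall i j, (i < j)%N -> (j <= n)%N -> forall a, m i a ->
  m i (sigma j a) /\ m i (delta j a).

Lemma Rs_subring i : (i <= n)%N -> subring (Rs i).
Proof. by move=> /hc [[]]. Qed.
Lemma m_ideal i : (i <= n)%N -> ideal_of (Rs i) (m i).
Proof. by move=> /hc [[_ [[]]]]. Qed.
Lemma m_not1 i : (i <= n)%N -> ~ m i 1.
Proof. by move=> /hc [[_ [[_ []]]]]. Qed.

Lemma Rs_mono i j : (i <= j)%N -> (j <= n)%N -> subset_of (Rs i) (Rs j).
Proof.
move=> /subnK <-; elim: (j - i)%N => [|q IH] hq a //.
rewrite addSn in hq *; move=> ha; have [_ [h _]] := hE hq.
by apply: h; apply: IH => //; apply: ltnW.
Qed.
Lemma m_mono i j : (i <= j)%N -> (j <= n)%N -> subset_of (m i) (m j).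
Proof.
move=> /subnK <-; elim: (j - i)%N => [|q IH] hq a //.
rewrite addSn in hq *; move=> ha; have [_ [_ [h _]]] := hE hq.
by apply: h; apply: IH => //; apply: ltnW.
Qed.

Lemma k_mulf_neq0 (a b : k) : a != 0 -> b != 0 -> a * b != 0.
Proof.
move=> ha hb; apply/eqP => e; move: hb; rewrite -[b](mulKr (kdiv ha)) e mulr0.
by rewrite eqxx.
Qed.

Lemma coords0 : exists cf, coords iota x 0 (Rs 0) (m 0) cf.
Proof.
have hA := Rs_subring (leq0n n); have hI := m_ideal (leq0n n).
have /fun_choice [inv hinv] : forall f, exists c, Rs 0 f -> iota c = f.
  move=> f; case: (classic (Rs 0 f)) => [/Rs0 [a ->]|h]; first by exists a.
  by exists 0.
have inv_iota c : inv (iota c) = c by apply: iota_inj; apply: hinv; apply/Rs0; exists c.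
have m0 f : m 0 f -> f = 0.
  move=> hf; have [c e] : exists a, f = iota a by apply/Rs0; apply: (ideal_sub hI).
  case: (eqVneq c 0) => [c0|/kdiv uc]; first by rewrite e c0 rmorph0.
  case: (m_not1 (leq0n n)); rewrite -(rmorph1 iota) -(mulVr uc) rmorphM -e.
  by apply: (idealMl hI) => //; apply/Rs0; exists c^-1.
exists (fun f _ => inv f); split.
- by move=> c; apply/Rs0; exists c.
- move=> f g _ hf hg _; apply: iota_inj.
  by rewrite rmorphB !hinv //; exact: (subringB hA).
- by move=> c f _ hf _; rewrite -{1}(hinv f hf) -rmorphM inv_iota.
- move=> K f hf; split.
    case: K => // K /(ipowS_ideal hA hI)/m0 -> _ _ _.
    by rewrite -(rmorph0 iota) inv_iota.
  case: K => [|K] h; first exact: ipow0.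
  by rewrite -(hinv f hf) (h [::]) // rmorph0; exact: (ipow_zero hA hI).
- move=> c; exists (iota (c [::])); first by apply/Rs0; exists (c [::]).
  by move=> [|//] _; rewrite inv_iota.
- by move=> [|//] _; exact: (subring1 hA).
- by move=> a b /size0nil -> /size0nil -> /=; rewrite -(rmorph1 iota) inv_iota.
- move=> f g a b hf hg [/size0nil -> hf0 _] [/size0nil -> hg0 _]; split=> //=.
    by rewrite -(hinv f hf) -(hinv g hg) -rmorphM inv_iota; apply: k_mulf_neq0.
  by move=> b' /size0nil ->.
Qed.

(** Elements of level [l] involve only the first [l] variables. This translates stability, a
    statement about the ideals [m l], into vanishing coefficients. *)
Definition supported i (cf : R -> seq nat -> k) :=
  forall l f a, (l <= i)%N -> Rs l f -> size a = i -> cf f a != 0 ->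
    sumn (take (i - l) a) = 0%N.

Lemma take_unit_exp i l u : (l <= u)%N -> (u < i)%N -> sumn (take (i - l) (unit_exp i u)) = 1%N.
Proof.
move=> hl hu; rewrite /unit_exp take_cat size_nseq ifF; last by apply/negP; lia.
rewrite sumn_cat sumn_nseq mul0n add0n (_ : _ - _ = (u - l).+1)%N; last by lia.
rewrite /= take_nseq ?sumn_nseq //; lia.
Qed.

(* Stability enters here: [sigma] maps [x l.+1] into [m l.+1], whose elements only involve
   the first [l.+1] variables. *)
Lemma sigma_lead i cf : (i < n)%N -> coords iota x i (Rs i) (m i) cf ->
  supported i cf -> (forall l, (l < i)%N -> m l.+1 (x l.+1)) ->
  forall f a, Rs i f -> lead i cf f a -> lead i cf (sigma i.+1 f) a.
Proof.
move=> hi H hsup hx.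
have hi' := ltnW hi; have hA := Rs_subring hi'; have hI := m_ideal hi'.
have [_ [_ [_ [[[hs _] [sI _]] _]]]] := hE hi.
apply: (aut_lead kdiv H hA hI (m_not1 hi') hs sI) => l a hl sa hla.
rewrite mon_unit_exp; apply/eqP; apply: NNPP => /negP hne.
have hli : (l.+1 <= n)%N by lia.
have [hz _] : m l.+1 (sigma i.+1 (x l.+1)) /\ _ := stable (hl : (l.+1 < i.+1)%N) hi (hx l hl).
have hsup' := hsup l.+1 _ a hl (ideal_sub (m_ideal hli) hz) sa hne.
have := ahead_le hla; rewrite sumn_unit_exp => hsum.
have [e|e] : sumn a = 0%N \/ sumn a = 1%N by lia.
  have hzi := m_mono hl hi' hz.
  by move: hne; rewrite (sumn0P sa e) ((co_I H hA hI (ideal_sub hI hzi)).1 hzi) eqxx.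
have [u hu eu] := sumn1P sa e.
move: hla; rewrite eu ahead_unit_exp // => hlu.
by move: hsup'; rewrite eu take_unit_exp.
Qed.

(** Coordinates, their support and the membership of the variables have to be built together, since
    [sigma_lead] uses all three to reach the next level. *)
Lemma tower i : (i <= n)%N ->
  (exists2 cf, coords iota x i (Rs i) (m i) cf & supported i cf) /\
  (forall l, (l < i)%N -> m l.+1 (x l.+1)).
Proof.
elim: i => [_|i IH hi].
  split=> //; have [cf H] := coords0; exists cf => // l f a.
  by rewrite leqn0 => /eqP -> _ /size0nil ->.
have [[cf H hsup] hx] := IH (ltnW hi).
have hi' := ltnW hi; have hA := Rs_subring hi'; have hI := m_ideal hi'.
have hres := co_res kdiv H hA hI.
have hlead := sigma_lead hi H hsup hx.
have /fun_choice [r hr] : forall b, exists r, Rs i.+1 b ->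
    coefs (Rs i) (Rs i.+1) (m i.+1) (x i.+1) r b.
  move=> b; case: (classic (Rs i.+1 b)) => [hb|hb]; last by exists (fun=> 0).
  by have [r hr] := coefs_ex (hE hi) hb; exists r.
have hx' l : (l < i.+1)%N -> m l.+1 (x l.+1).
  rewrite ltnS leq_eqVlt => /orP [/eqP ->|]; last exact: hx.
  exact: (var_in_J (hc hi') (hc hi) (hE hi)).
split=> //; exists (next_coef cf r).
  exact: (coords_step (hc hi') (hc hi) (hE hi) hres H hlead hr).
move=> l f [//|t a]; rewrite leq_eqVlt => /orP [/eqP ->|]; first by rewrite subnn take0.
rewrite ltnS => hl hf [sa].
rewrite (next_coef_low (hc hi') (hc hi) (hE hi) H hr) //; last exact: (Rs_mono hl hi').
case: (eqVneq t 0%N) => [->|_]; last by rewrite eqxx.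
by move=> hne; rewrite subSn //= (hsup l f a hl hf sa hne).
Qed.

(** In [x a r = sigma(a) x r + delta(a) r] stability keeps both [sigma(a)] and [delta(a)] in
    [m j]. *)
Lemma rspan_var j l g : (j <= l)%N -> (l < n)%N -> rspan (m j) g -> rspan (m j) (x l.+1 * g).
Proof.
move=> hjl hl; have hj : (j <= n)%N by lia.
elim=> [|a r f ha _ IH]; first by rewrite mulr0; exact: rspan0.
have [_ [_ [_ [_ [_ [h _]]]]]] := hE hl.
have haR : Rs l a by apply: (Rs_mono hjl (ltnW hl)); exact: (ideal_sub (m_ideal hj)).
have [hs hd] := stable (hjl : (j < l.+1)%N) hl ha.
rewrite mulrDr mulrA h // mulrDl -addrA -mulrA; apply: rspan_add => //.
exact: rspan_add.
Qed.

Local Notation pw := (ideal_pow (Rs n) (m n)).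
Let hAn : subring (Rs n) := Rs_subring (leqnn n).
Let hIn : ideal_of (Rs n) (m n) := m_ideal (leqnn n).

Lemma ipow_Rs_mono i K a : (i <= n)%N -> ideal_pow (Rs i) (m i) K a -> pw K a.
Proof. by move=> hi; apply: ipow_mono; [exact: Rs_mono|exact: m_mono]. Qed.

(** A left factor is a series in [x_l], so it is truncated: powers of [x_l] pass by [rspan_var],
    coefficients by induction on the level, down to level [j] where [m j] is an ideal. This is only
    approximate, which is why a closure is needed. *)
Lemma rspan_left j l r g K : (j <= l)%N -> (l <= n)%N -> Rs l r -> rspan (m j) g ->
  exists2 g', rspan (m j) g' & pw K (r * g - g').
Proof.
move=> + hln; elim: l hln r g => [|l IH] hln r g hjl hr.
  have -> : j = 0%N by lia.
  elim=> [|a r' f ha _ [g' hg' hp]].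
    by exists 0; [exact: rspan0|rewrite mulr0 subr0; exact: (ipow_zero hAn hIn)].
  exists (r * a * r' + g'); first by apply: rspan_add => //; exact: (idealMl (m_ideal (leq0n n))).
  by rewrite mulrDr mulrA opprD addrACA subrr add0r.
move: hjl; rewrite leq_eqVlt => /orP [/eqP ej|hjl].
  elim=> [|a r' f ha _ [g' hg' hp]].
    by exists 0; [exact: rspan0|rewrite mulr0 subr0; exact: (ipow_zero hAn hIn)].
  exists (r * a * r' + g').
    by apply: rspan_add => //; rewrite ej in ha *; exact: (idealMl (m_ideal hln)).
  by rewrite mulrDr mulrA opprD addrACA subrr add0r.
move=> hg; have hl' := ltnW hln.
have [u hu] := coefs_ex (hE hln) hr; have [huA _] := hu.
have hmod := coefs_mod (hc hl') (hc hln) (hE hln) K hu.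
have hyt t : rspan (m j) (x l.+1 ^+ t * g).
  elim: t => [|t IHt]; first by rewrite expr0 mul1r.
  by rewrite exprS -mulrA; apply: rspan_var.
have /fun_choice [g' hg'] : forall t, exists g', rspan (m j) g' /\
    pw K (u t * (x l.+1 ^+ t * g) - g').
  by move=> t; have [g' h1 h2] := IH hl' (u t) _ hjl (huA t) (hyt t); exists g'.
exists (\sum_(t < K) g' t).
  by apply: rspan_sum => t _; case: (hg' t).
rewrite -[r](subrK (series_partial u (x l.+1) K)) mulrDl -addrA; apply: (ipowD hAn hIn).
  by apply: (ipowMr hAn hIn) => //; apply: ipow_Rs_mono hmod.
rewrite mulr_suml -sumrB; apply: (ipow_sum hAn hIn) => t _.
by rewrite -mulrA; case: (hg' t).
Qed.

(** * The chain of completely prime ideals *)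

Section Lower.
Variable cf : R -> seq nat -> k.
Hypothesis H : coords iota x n (Rs n) (m n) cf.
Local Notation mon := (mon x).

(** The last [j] entries are the powers of [x_1, ..., x_j], so a pure exponent involves only later
    variables. *)
Definition pure j (a : seq nat) := drop (n - j) a = nseq j 0%N.
Definition var_ideal j (h : R) := forall a, size a = n -> pure j a -> cf h a = 0.

Lemma mon_cat (a : seq nat) j : exists u, forall c, size c = j -> mon (a ++ c) = mon c * u.
Proof.
elim: a => [|l a [u hu]]; first by exists 1 => c _; rewrite mulr1.
exists (u * x (size a + j).+1 ^+ l) => c sc /=.
by rewrite hu // size_cat sc mulrA.
Qed.

Lemma var_idealD j f g : var_ideal j f -> var_ideal j g -> var_ideal j (f + g).
Proof. by move=> hf hg a sa ha; rewrite (coD H hAn) // hf ?hg ?addr0. Qed.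

(* With [rspan_var_ideal] and [var_ideal_closed], this identifies [var_ideal j] with the closure of
   the right ideal generated by [m j]. *)
Lemma var_ideal_rspan_approx j h K : (j <= n)%N -> var_ideal j h ->
  exists2 g, rspan (m j) g & pw K (h - g).
Proof.
move=> hj hP.
exists (\sum_(a <- exps_below n K) iota (cf h a) * mon a); last exact: (co_approx H hAn).
apply: rspan_sum => a; rewrite mem_exps_below => /andP [/eqP sa _].
case: (classic (pure j a)) => [ha|ha]; first by rewrite hP // rmorph0 mul0r; exact: rspan0.
have [u hu] := mon_cat (take (n - j) a) j.
have sd : size (drop (n - j) a) = j by rewrite size_drop sa subKn.
rewrite -[in X in mon X](cat_take_drop (n - j) a) hu // mulrA; apply: rspan_gen.
have [[cj Hj _] _] := tower hj.
have hAj := Rs_subring hj; have hIj := m_ideal hj.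
have ht : Rs j (iota (cf h a) * mon (drop (n - j) a)).
  by apply: (subringM hAj); [exact: (co_iota Hj)|exact: (co_monA Hj)].
apply/(co_I Hj hAj hIj ht); rewrite (co_term Hj) ?size_nseq //.
by case: eqP.
Qed.

Lemma var_ideal_closed j h : (j <= n)%N ->
  (forall K, exists2 g, var_ideal j g & pw K (h - g)) -> var_ideal j h.
Proof.
move=> hj hP a sa ha; have [g hg hp] := hP (sumn a).+1.
have := co_pow H hAn hIn hp sa (ltnSn _).
by rewrite (coB H) // hg // subr0.
Qed.

(** For each monomial of [r], the part in the first [j] variables is absorbed into [a], which stays
    in [m j] and has no constant term at level [j]. The later part remains on the right, so no pure
    exponent arises. *)
Lemma var_ideal_gen j a r : (j <= n)%N -> m j a -> var_ideal j (a * r).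
Proof.
move=> hj ha; have [[cj Hj _] _] := tower hj.
have hAj := Rs_subring hj; have hIj := m_ideal hj.
apply: var_ideal_closed => // K.
pose F b := a * (iota (cf r b) * mon b).
have hF b : b \in exps_below n K -> var_ideal j (F b).
  rewrite mem_exps_below => /andP [/eqP sb _]; apply: var_ideal_closed => // Q.
  have [u hu] := mon_cat (take (n - j) b) j.
  have sd : size (drop (n - j) b) = j by rewrite size_drop sb subKn.
  pose a1 := a * (iota (cf r b) * mon (drop (n - j) b)).
  have ha1 : m j a1.
    apply: (idealMr hIj) => //.
    by apply: (subringM hAj); [exact: (co_iota Hj)|exact: (co_monA Hj)].
  have ha1A := ideal_sub hIj ha1.
  have -> : F b = a1 * u.
    by rewrite /F /a1 -[in X in mon X](cat_take_drop (n - j) b) hu // !mulrA.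
  exists ((\sum_(c <- exps_below j Q) iota (cj a1 c) * mon c) * u); last first.
    rewrite -mulrBl; apply: (ipowMr hAn hIn) => //; apply: (ipow_Rs_mono hj).
    exact: (co_approx Hj hAj).
  rewrite mulr_suml big_seq; apply: big_ind.
  - by move=> e se _; rewrite (co0 H).
  - by move=> f g; exact: var_idealD.
  - move=> c; rewrite mem_exps_below => /andP [/eqP sc _] e se he.
    rewrite -mulrA -hu // (co_term H) //; last first.
      by rewrite size_cat size_takel ?sc ?sb ?leq_subr // subnK.
    case: eqP => // ee; move: he; rewrite /pure -ee drop_size_cat; last first.
      by rewrite size_takel ?sb ?leq_subr.
    by move=> ->; apply/(co_I Hj hAj hIj ha1A).
exists (\sum_(b <- exps_below n K) F b).
  rewrite big_seq; apply: big_ind => //; [by move=> e se _; rewrite (co0 H)|exact: var_idealD].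
rewrite -mulr_sumr -mulrBr; apply: (ipowMl hAn) => //.
exact: (co_approx H hAn).
Qed.

Lemma rspan_var_ideal j g : (j <= n)%N -> rspan (m j) g -> var_ideal j g.
Proof.
move=> hj; elim=> [|a r f ha _ IH]; first by move=> a sa _; rewrite (co0 H).
by apply: var_idealD => //; exact: var_ideal_gen.
Qed.

Lemma var_ideal_ideal j : (j <= n)%N -> ideal_of (@full_set R) (var_ideal j).
Proof.
move=> hj; split=> //; split; first by move=> a sa _; rewrite (co0 H).
split; first exact: var_idealD.
move=> a b _ hb; split; apply: var_ideal_closed => // K; have [g hg hp] := var_ideal_rspan_approx K hj hb.
  have [g' hg' hp'] := rspan_left K hj (leqnn n) (Rsn a) hg.
  exists g'; first exact: rspan_var_ideal.
  apply: (ipow_trans hAn hIn _ hp'); rewrite -mulrBr; exact: (ipowMl hAn).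
exists (g * a); first by apply: rspan_var_ideal => //; exact: rspanMr.
by rewrite -mulrBl; apply: (ipowMr hAn hIn).
Qed.

Lemma var_ideal_not1 j : (j <= n)%N -> ~ var_ideal j 1.
Proof.
move=> hj h; have := h (nseq n 0%N); rewrite size_nseq /pure drop_nseq subKn // => /(_ erefl erefl).
by rewrite -(rmorph1 iota) (co_iotaE H) ?size_nseq // eqxx => /eqP; rewrite oner_eq0.
Qed.

Lemma pure_expadd j a b : size a = n -> size b = n -> pure j a -> pure j b -> pure j (expadd a b).
Proof.
have drop_expadd q (c e : seq nat) : drop q (expadd c e) = expadd (drop q c) (drop q e).
  elim: q c e => [|q IH] [|i c] [|l e] //=; rewrite ?drop0 //.
  by case: (drop q c).
by rewrite /pure drop_expadd => _ _ -> ->; rewrite expadd0 // size_nseq.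
Qed.

(** Modulo the ideal both factors may be replaced by their parts on pure exponents. Pure exponents
    are closed under addition, so the least exponent of the product is pure. *)
Lemma var_ideal_completely_prime j f g : (j <= n)%N -> var_ideal j (f * g) -> var_ideal j f \/ var_ideal j g.
Proof.
move=> hj hfg; have hI := var_ideal_ideal hj.
have hsub : subring (@full_set R) by [].
have red h : ~ var_ideal j h -> exists h' a, [/\ var_ideal j (h - h'), lead n cf h' a & pure j a].
  move=> hh.
  have [h' _ hh'] := co_surj H (fun a => if drop (n - j) a == nseq j 0%N then cf h a else 0).
  have hP : var_ideal j (h - h').
    by move=> a sa pa; rewrite (coB H) // hh' // pa eqxx subrr.
  have [a la] : exists a, lead n cf h' a.
    apply: lead_ex; apply: NNPP => hne; apply: hh.
    rewrite -[h](subrK h'); apply: (idealD hI) => // a sa _.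
    by apply/eqP; apply: NNPP => /negP hn; apply: hne; exists a.
  exists h', a; split=> //; case: la => sa ha _; move: ha; rewrite hh' //.
  by rewrite /pure; case: (eqVneq (drop (n - j) a)) => // _; rewrite eqxx.
apply: NNPP => /not_or_and [/red [f' [a [hf la pa]]] /red [g' [b [hg lb pb]]]].
have : var_ideal j (f' * g').
  have -> : f' * g' = f * g - ((f - f') * g + f' * (g - g')).
    by rewrite mulrBl mulrBr; zmod.
  apply: (idealB hsub hI) => //; apply: (idealD hI); first exact: (idealMr hI).
  exact: (idealMl hI).
have [sab + _] := co_leadM H (Rsn f') (Rsn g') la lb.
move=> /eqP hne hP; apply: hne; apply: hP => //.
by apply: pure_expadd => //; [case: la|case: lb].
Qed.

Lemma lower_bound : exists P : nat -> R -> Prop, prime_chain P n.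
Proof.
exists var_ideal; split=> j hj.
  split; first exact: var_ideal_ideal.
  split; first exact: var_ideal_not1.
  move=> I J hI hJ hIJ; apply: NNPP => /not_or_and [h1 h2].
  have witness L : ~ subset_of L (var_ideal j) -> exists2 f, L f & ~ var_ideal j f.
    by move=> h; apply: NNPP => hne; apply: h => f hf; apply: NNPP => hf'; apply: hne; exists f.
  have [[f hf hf'] [g hg hg']] := (witness I h1, witness J h2).
  by case: (var_ideal_completely_prime hj (hIJ f g hf hg)).
split.
  move=> h hh a sa pa; apply: hh => //.
  have e : (n - j = 1 + (n - j.+1))%N by lia.
  by rewrite /pure e -drop_drop pa /= drop0.
exists (mon (unit_exp n j)).
  move=> a sa pa; rewrite (co_mon H) ?size_unit_exp //; case: eqP => // ea.
  move: pa; rewrite /pure -ea /unit_exp drop_size_cat ?size_nseq //.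
move=> /(_ (unit_exp n j)); rewrite size_unit_exp // => /(_ erefl).
rewrite (co_mon H) ?size_unit_exp // eqxx => h; have /h/eqP : pure j (unit_exp n j); last by rewrite oner_eq0.
have e : (n - j = 1 + (n - j.+1))%N by lia.
by rewrite /pure e -drop_drop /unit_exp drop_size_cat ?size_nseq //= drop0.
Qed.
End Lower.
End Tower.
(** * Regular elements modulo a prime ideal *)

Section Goldie.
Variable R : nzRingType.
Implicit Types (L : R -> Prop).
Local Notation left_ideal := (left_ideal_of (@full_set R)).
Local Notation ideal := (ideal_of (@full_set R)).

Lemma left_ideal_sum L (T : Type) (s : seq T) (Q : pred T) (F : T -> R) : left_ideal L ->
  (forall i, Q i -> L (F i)) -> L (\sum_(i <- s | Q i) F i).
Proof. by move=> [_ [h0 [hD _]]] h; apply: big_ind. Qed.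

Definition fin_gen L := exists (N : nat) (g : nat -> R), (forall i, (i < N)%N -> L (g i)) /\
  forall z, L z -> exists q : nat -> R, z = \sum_(i < N) q i * g i.

(** Without a maximal member, choice builds a strictly increasing chain; the finitely many
    generators of its union already lie in one member. *)
Lemma max_left_ideal (F : (R -> Prop) -> Prop) :
  (forall L, left_ideal L -> fin_gen L) ->
  (exists L, F L) -> (forall L, F L -> left_ideal L) ->
  exists L, F L /\ forall L', F L' -> subset_of L L' -> subset_of L' L.
Proof.
move=> hfg [L0 hL0] hF; apply: NNPP => hno.
have /fun_choice [f hf] : forall L, exists L', F L ->
    [/\ F L', subset_of L L' & ~ subset_of L' L].
  move=> L; apply: NNPP => hne; have FL : F L.
    by apply: NNPP => h; apply: hne; exists L.
  apply: hno; exists L; split=> // L' FL' hLL'; apply: NNPP => h.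
  by apply: hne; exists L'.
pose c i := iter i f L0.
have Fc i : F (c i) by elim: i => //= i /hf [].
have cS i : subset_of (c i) (c i.+1) by case: (hf _ (Fc i)).
have c_mono i j : (i <= j)%N -> subset_of (c i) (c j).
  by move=> /subnK <-; elim: (j - i)%N => [|q IH] z // /IH; exact: cS.
pose U z := exists i, c i z.
have hU : left_ideal U.
  split=> //; split; first by exists 0%N; case: (hF _ (Fc 0%N)) => _ [].
  split.
    move=> a b [i hi] [j hj]; exists (maxn i j).
    case: (hF _ (Fc (maxn i j))) => _ [_ [h _]]; apply: h.
      exact: (c_mono _ _ (leq_maxl i j)).
    exact: (c_mono _ _ (leq_maxr i j)).
  by move=> a b ha [i hi]; exists i; case: (hF _ (Fc i)) => _ [_ [_ h]]; apply: h.
have [N [g [hg hgen]]] := hfg U hU.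
have [M hM] : exists M, forall i, (i < N)%N -> c M (g i).
  elim: N hg {hgen} => [|N IH] hg; first by exists 0%N.
  have [M hM] : exists M, forall i, (i < N)%N -> c M (g i).
    by apply: IH => i hi; apply: hg; apply: ltnW.
  have [j hj] := hg N (ltnSn N).
  exists (maxn M j) => i; rewrite ltnS leq_eqVlt => /orP [/eqP ->|/hM].
    exact: (c_mono _ _ (leq_maxr M j)).
  exact: (c_mono _ _ (leq_maxl M j)).
case: (hf _ (Fc M)) => _ _; apply => z hz.
have [q ->] := hgen z (ex_intro _ M.+1 hz).
have hlM := hF _ (Fc M); apply: left_ideal_sum => // i _.
by case: hlM => _ [_ [_ h]]; apply: h => //; apply: hM.
Qed.

Hypothesis maxc : forall F : (R -> Prop) -> Prop,
  (exists L, F L) -> (forall L, F L -> left_ideal L) ->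
  exists L, F L /\ forall L', F L' -> subset_of L L' -> subset_of L' L.

Variable P : R -> Prop.
Hypothesis hP : prime_ideal P.

Let PI : ideal P. Proof. by case: hP. Qed.
Let P0 : P 0. Proof. by case: PI => _ []. Qed.
Let PD a b : P a -> P b -> P (a + b). Proof. by case: PI => _ [_ [h _]]; apply: h. Qed.
Let PMl a b : P b -> P (a * b). Proof. by case: PI => _ [_ [_ h]] /(h a) []. Qed.
Let PMr a b : P a -> P (a * b). Proof. by case: PI => _ [_ [_ h]] /(h b) []. Qed.
Let PN a : P a -> P (- a). Proof. by move=> h; rewrite -mulN1r; apply: PMl. Qed.
Let PDl a b : P a -> P (a + b) -> P b.
Proof. by move=> ha hab; rewrite -[b](addKr a); apply: PD => //; apply: PN. Qed.

(** Annihilators modulo [P] replace the ideals generated by [a] and [b]: [J] contains [b], [I]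
    contains [a], and closure is immediate. *)
Lemma prime_elem a b : (forall r, P (a * r * b)) -> P a \/ P b.
Proof.
move=> h.
pose J y := forall r s, P (a * r * y * s).
pose I z := forall r y, J y -> P (z * r * y).
have hJ : ideal J.
  split=> //; split; first by move=> r s; rewrite mulr0 mul0r.
  split; first by move=> u v hu hv r s; rewrite mulrDr mulrDl; apply: PD.
  move=> u v _ hv; split=> r s.
    by have := hv (r * u) s; rewrite !mulrA.
  by have := hv r (u * s); rewrite !mulrA.
have hI : ideal I.
  split=> //; split; first by move=> r y _; rewrite !mul0r.
  split; first by move=> u v hu hv r y hy; rewrite !mulrDl; apply: PD; [apply: hu|apply: hv].
  move=> u v _ hv; split=> r y hy.
    by rewrite -!mulrA; apply: PMl; rewrite mulrA; apply: hv.
  by have := hv (u * r) y hy; rewrite !mulrA.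
have [_ [_ hpr]] := hP; case: (hpr I J hI hJ).
- by move=> u v hu hv; have := hu 1 v hv; rewrite mulr1.
- by move=> hs; left; apply: hs => r y hy; have := hy r 1; rewrite mulr1.
- by move=> hs; right; apply: hs => r s; apply: PMr.
Qed.

Definition lann c : R -> Prop := fun a => P (a * c).

Lemma lann_left c : left_ideal (lann c).
Proof.
split=> //; split; first by rewrite /lann mul0r.
split; first by move=> a b ha hb; rewrite /lann mulrDl; apply: PD.
by move=> a b _ hb; rewrite /lann -mulrA; apply: PMl.
Qed.

(* Utumi's argument: an element [a] of [b R] outside [P] with maximal left
   annihilator satisfies [a R a] in [P]. *)
Lemma nil_left_ideal (Y : R -> Prop) : left_ideal Y ->
  (forall y, Y y -> exists i, P (y ^+ i)) -> forall b, Y b -> P b.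
Proof.
move=> [_ [_ [_ hY]]] hnil b hb; apply: NNPP => Pb.
pose F L := exists x, ~ P (b * x) /\ L = lann (b * x).
have [||L [[x [Px ->]] hmax]] := maxc (F := F).
- by exists (lann (b * 1)), 1; rewrite mulr1.
- by move=> L [x [_ ->]]; exact: lann_left.
set a := b * x in Px hmax.
suff h : forall r, P (a * r * a) by case: (prime_elem h).
move=> r; apply: NNPP => hr.
pose w := a * r.
have hw : exists i, P (w ^+ i).
  (* Powers of [w = b x r] contain powers of [x r b], which lies in the left ideal [Y]. *)
  have [i hi] := hnil (x * r * b) (hY _ _ I hb).
  exists i.+1; have -> : w ^+ i.+1 = b * (x * r * b) ^+ i * (x * r).
    elim: i {hi} => [|i IH]; first by rewrite expr1 expr0 mulr1 /w /a mulrA.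
    by rewrite exprS IH [in RHS]exprS /w /a !mulrA.
  by apply: PMr; apply: PMl.
case: hw => i; elim: i => [|i IH hi].
  by rewrite expr0 => h1; apply: Px; rewrite -[a]mul1r; apply: PMr.
apply: IH; case: i hi => [|i hi].
  by rewrite expr1 => hi; case: hr; apply: PMr.
(* Were [w^(i+1)] outside [P], maximality would force anything killing it from the left to kill [a].
   As [w] kills it, [w a = a r a] would lie in [P]. *)
apply: NNPP => hne.
pose v := x * r * w ^+ i.
have ev : w ^+ i.+1 = b * v by rewrite exprS /w /v /a !mulrA.
apply: hr; have hsub : subset_of (lann a) (lann (b * v)).
  move=> t ht; rewrite /lann -ev (_ : t * w ^+ i.+1 = t * a * (r * w ^+ i)).
    exact: PMr.
  by rewrite exprS /w !mulrA.
have FL : F (lann (b * v)) by exists v; rewrite -ev.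
apply: (hmax _ FL hsub); rewrite /lann -ev.
by have := hi; rewrite exprS.
Qed.

(** By [nil_left_ideal] some [b] in [Y] has no power in [P]; the power of [b] with maximal left
    annihilator has the same annihilator as its square. *)
Lemma exists_stable_elem (Y : R -> Prop) : left_ideal Y -> ~ subset_of Y P ->
  exists u, [/\ Y u, ~ P u & forall a, P (a * u * u) -> P (a * u)].
Proof.
move=> hY hYP.
have [b hb hbn] : exists2 b, Y b & forall i, ~ P (b ^+ i).
  apply: NNPP => hne; apply: hYP; apply: nil_left_ideal => // y hy.
  by apply: NNPP => hy'; apply: hne; exists y => // i hi; apply: hy'; exists i.
pose F L := exists i, L = lann (b ^+ i.+1).
have [||L [[i ->] hmax]] := maxc (F := F).
- by exists (lann (b ^+ 1)), 0%N.
- by move=> L [i ->]; exact: lann_left.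
exists (b ^+ i.+1); split=> //.
  by case: hY => _ [_ [_ h]]; rewrite exprSr; apply: h.
move=> a ha; apply: (hmax (lann (b ^+ (i + i.+1).+1))).
- by exists (i + i.+1)%N.
- by move=> t ht; rewrite /lann -addSn exprD mulrA; apply: PMr.
- by rewrite /lann -addSn exprD mulrA.
Qed.

(* A maximal left ideal [S] independent of [lann c] for some [c] of [Q]: adding to
   [c] a stable element of [lann c] would enlarge [S]. *)
Lemma regular_elem (Q : R -> Prop) : ideal Q -> ~ subset_of Q P ->
  exists2 c, Q c & forall a, P (a * c) -> P a.
Proof.
move=> hQ hQP.
have [_ [Q0 [QD QM]]] := hQ.
pose F S := left_ideal S /\ exists c, [/\ Q c, forall a, S a -> P (a * c) -> P a &
  forall a, P (a * c * c) -> P (a * c)].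
have [||S [[hS [c [Qc hc hcc]]] hmax]] := maxc (F := F).
(* The family is not empty: [S = P] is admissible with [c = 0]. *)
- exists P; split; last by exists 0; split=> // a; rewrite !mulr0.
  by case: PI => h1 [h2 [h3 h4]]; split=> //; split=> //; split=> // a b ha hb; case: (h4 a b ha hb).
- by move=> L [].
exists c => //.
have [_ [S0 [SD SM]]] := hS.
pose X a := P (a * c) /\ Q a.
have hX : left_ideal X.
  split=> //; split; first by split; rewrite ?mul0r.
  split; first by move=> a b [ha ha'] [hb hb']; split; [rewrite mulrDl; exact: PD|exact: QD].
  by move=> a b _ [hb hb']; split; [rewrite -mulrA; exact: PMl|case: (QM a b I hb')].
have hXP : subset_of X P.
  apply: NNPP => /(exists_stable_elem hX) [u [[uc Qu] Pu hu]].
  pose S' z := exists a r, S a /\ z = a + r * u.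
  (* Since [u c] is in [P], right multiplication by [c] leaves only [a c c]. *)
  have split_cu a b : P (a * c + b * u) -> P (a * c).
    move=> h; apply: hcc; have h2 := PMr c h; rewrite mulrDl addrC in h2.
    by apply: PDl h2; rewrite -mulrA; exact: PMl.
  have FS' : F S'.
    split.
      split=> //; split; first by exists 0, 0; rewrite mul0r addr0.
      split.
        move=> _ _ [a [r [ha ->]]] [b [t [hb ->]]]; exists (a + b), (r + t).
        by split; [exact: SD|rewrite mulrDl addrACA].
      move=> t _ ht [a [r [ha ->]]]; exists (t * a), (t * r).
      by split; [exact: SM|rewrite mulrDr mulrA].
    exists (c + u); split; first exact: QD.
      move=> _ [a [r [ha ->]]] h.
      have e : (a + r * u) * (c + u) = r * u * c + (a * c + (a + r * u) * u).
        by rewrite mulrDr !mulrDl; zmod.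
      rewrite e in h; have {}h : P (a * c + (a + r * u) * u).
        by apply: PDl h; rewrite -mulrA; exact: PMl.
      have Pa := hc a ha (split_cu _ _ h).
      apply: PD => //; apply: hu; have h2 := PDl (PMr c Pa) h.
      by rewrite mulrDl in h2; apply: PDl h2; exact: PMr.
    move=> a h.
    have e : a * (c + u) * (c + u) = a * u * c + (a * c * c + (a * (c + u) * u)).
      by rewrite !mulrDr !mulrDl; zmod.
    rewrite e in h; have {}h : P (a * c * c + (a * (c + u) * u)).
      by apply: PDl h; rewrite -mulrA; exact: PMl.
    have hac := hcc _ (split_cu _ _ h).
    rewrite mulrDr; apply: PD => //; apply: hu; have h2 := PDl (PMr c hac) h.
    by rewrite mulrDr mulrDl in h2; apply: PDl h2; exact: PMr.
  apply: Pu; apply: hc uc; apply: (hmax S' FS').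
    by move=> a ha; exists a, 0; rewrite mul0r addr0.
  by exists 0, 1; rewrite mul1r add0r.
(* The annihilator of [c] is known to be in [P] only inside [Q]; multiplying by [q] leads into [Q],
   and primeness removes [q] again. *)
have [q Qq Pq] : exists2 q, Q q & ~ P q.
  by apply: NNPP => hne; apply: hQP => q hq; apply: NNPP => hq'; apply: hne; exists q.
move=> a ha; have [r||//] := @prime_elem q a; last by move/Pq.
apply: hXP; split; first by rewrite -mulrA; exact: PMl.
have [_ h1] := QM r q I Qq.
by have [_ h2] := QM a _ I h1.
Qed.

End Goldie.
(** * The upper bound *)

Section Upper.
Variables (k : unitRingType) (R : nzRingType) (iota : {rmorphism k -> R}) (x : nat -> R).
Hypothesis kdiv : forall a : k, a != 0 -> a \is a GRing.unit.
Variables (n : nat) (A I : R -> Prop) (cf : R -> seq nat -> k).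
Hypothesis H : coords iota x n A I cf.
Hypothesis hA : subring A.
Hypothesis hI : ideal_of A I.
Hypothesis full : forall r, A r.
Hypothesis sep : forall f, (forall K, ideal_pow A I K f) -> f = 0.
Local Notation pw := (ideal_pow A I).
Local Notation mon := (mon x).
Local Notation lead := (lead n cf).
Local Notation left_ideal := (left_ideal_of (@full_set R)).
Local Notation ideal := (ideal_of (@full_set R)).

Lemma ipow_coefP K f : pw K f <-> forall a, size a = n -> (sumn a < K)%N -> cf f a = 0.
Proof. exact: (coP H). Qed.

(** The sum is prescribed coefficient by coefficient: terms with [t > sumn a + s] do not reach the
    exponent [a]. *)
Lemma ipow_series s (f : nat -> R) : (forall t, pw (t - s) (f t)) ->
  exists F, forall T, pw (T - s) (F - \sum_(t < T) f t).
Proof.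
move=> hf.
have [F _ hF] := co_surj H (fun a => \sum_(t < (sumn a + s).+1) cf (f t) a).
exists F => T; apply/ipow_coefP => a sa ha.
rewrite (coB H) // (co_sum H hA) // hF //.
have hT : ((sumn a + s).+1 <= T)%N by lia.
rewrite -(subnKC hT) big_split_ord /= [X in _ - (_ + X)]big1 ?addr0 ?subrr // => t _.
by apply: (co_pow H hA hI (hf _) sa); lia.
Qed.

(** * Division by a standard basis *)

Section Division.
Variables (L : R -> Prop) (N : nat) (g : nat -> R) (G : nat -> seq nat).
Hypothesis hL : left_ideal L.
Hypothesis Lg : forall i, (i < N)%N -> L (g i).
Hypothesis leadg : forall i, (i < N)%N -> lead (g i) (G i).
Hypothesis cover : forall z a, L z -> lead z a ->
  exists i b, [/\ (i < N)%N, size b = n & a = expadd b (G i)].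

Let L0 : L 0. Proof. by case: hL => _ []. Qed.
Let LD a b : L a -> L b -> L (a + b). Proof. by case: hL => _ [_ [h _]]; apply: h. Qed.
Let LM a b : L b -> L (a * b). Proof. by case: hL => _ [_ [_ h]]; apply: h. Qed.
Let LB a b : L a -> L b -> L (a - b).
Proof. by move=> ha hb; apply: LD => //; rewrite -mulN1r; apply: LM. Qed.

(** A crude common bound for the degrees of the [G i], hence for the order lost by the quotients. *)
Definition shift := (\sum_(i < N) sumn (G i))%N.

(** Each reduction moves the least exponent further back among the finitely many exponents of degree
    [d], until nothing of that degree is left. *)
Lemma division_step d z : L z -> pw d z ->
  exists q : nat -> R, (forall i, pw (d - shift) (q i)) /\
    pw d.+1 (z - \sum_(i < N) q i * g i).
Proof.
have hz0 z' : pw d.+1 z' -> exists q : nat -> R, (forall i, pw (d - shift) (q i)) /\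
    pw d.+1 (z' - \sum_(i < N) q i * g i).
  exists (fun=> 0); split; first by move=> i; exact: (ipow_zero hA hI).
  by rewrite big1 ?subr0 // => i _; rewrite mul0r.
pose mu a := count (ahead a) (exps_below n d.+1).
suff main M : forall z, L z -> pw d z ->
    (forall a, lead z a -> sumn a = d -> (mu a < M)%N) ->
    exists q : nat -> R, (forall i, pw (d - shift) (q i)) /\
    pw d.+1 (z - \sum_(i < N) q i * g i).
  move=> Lz hz; apply: (main (size (exps_below n d.+1)).+1 z Lz hz) => a _ _.
  by rewrite ltnS; exact: count_size.
have lead_deg z' : pw d z' -> ~ pw d.+1 z' -> exists2 a, lead z' a & sumn a = d.
  move=> hz' hnz.
  have [a0 s0 [h0 c0]] : exists2 a, size a = n & (sumn a < d.+1)%N /\ cf z' a != 0.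
    apply: NNPP => hne; apply: hnz; apply/ipow_coefP => a sa ha; apply/eqP.
    by apply: NNPP => /negP h; apply: hne; exists a.
  have [a la] := lead_ex (ex_intro2 _ _ a0 s0 c0).
  exists a => //; apply/eqP; rewrite eqn_leq; apply/andP; split.
    rewrite leqNgt; apply/negP => hda; case: la => sa _ hm; case/eqP: c0.
    by apply: hm => //; apply/orP; left; lia.
  rewrite leqNgt; apply/negP => hda; case: la => sa /eqP ha _; apply: ha.
  exact: (co_pow H hA hI hz' sa).
elim: M => [|M IH] {}z Lz hz hM; case: (classic (pw d.+1 z)) => [/hz0 //|/(lead_deg z hz) [a la da]].
  by have := hM a la da.
have [i [b [hi sb ea]]] := cover Lz la.
have sG : size (G i) = n by case: (leadg hi).
have lb : lead (mon b) b.
  split=> //; first by rewrite (co_mon H) // eqxx oner_eq0.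
  move=> c sc hc; rewrite (co_mon H) //; case: eqP => // e.
  by move: hc; rewrite e ahead_irr.
have := co_leadM H (full _) (full _) lb (leadg hi); rewrite -ea => -[sa he hm].
set e := cf _ a in he.
pose h := iota (cf z a / e) * mon b.
have hh : pw (d - shift) h.
  apply: (ipowMl hA) => //; apply/ipow_coefP => c sc hc; rewrite (co_mon H) //; case: eqP => // ebc.
  move: hc; rewrite -ebc -da ea sumn_expadd ?sb // /shift (bigD1 (Ordinal hi)) //=; lia.
pose z' := z - h * g i.
have ez' c : size c = n -> cf z' c = cf z c - cf z a / e * cf (mon b * g i) c.
  by move=> sc; rewrite /z' /h -mulrA (coB H) // (coZ H).
have Lz' : L z' by apply: LB => //; apply: LM; exact: Lg.
have z'a : cf z' a = 0 by rewrite ez' // -/e divrK ?kdiv // subrr.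
have z'lt c : size c = n -> ahead c a -> cf z' c = 0.
  by move=> sc hc; rewrite ez' // hm // mulr0 subr0; case: la => _ _; apply.
have hz' : pw d z'.
  by apply/ipow_coefP => c sc hc; apply: z'lt => //; apply/orP; left; rewrite da.
have [|q [hq hq']] := IH z' Lz' hz'.
  move=> c lc dc; case: (lc) => sc hc _.
  have hac : ahead a c.
    have := @ahead_total a c; rewrite sa sc => /(_ erefl) /or3P [//|/eqP eac|hca].
      by move: hc; rewrite -eac z'a eqxx.
    by move: hc; rewrite z'lt // eqxx.
  rewrite -ltnS; apply: leq_trans (hM a la da); rewrite ltnS.
  apply: (@count_lt _ _ _ _ c); first by rewrite mem_exps_below sc dc eqxx ltnSn.
  - by move=> y /(ahead_trans hac).
  - exact: hac.
  - by rewrite ahead_irr.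
exists (fun j => q j + if j == i then h else 0); split.
  move=> j; apply: (ipowD hA hI) => //; case: eqP => // _; exact: (ipow_zero hA hI).
rewrite (_ : z - _ = z' - \sum_(j < N) q j * g j) //.
under eq_bigr => j _ do rewrite mulrDl.
rewrite big_split /= [X in _ - (_ + X)](bigD1 (Ordinal hi)) //= eqxx.
rewrite [X in _ + (_ + X)]big1 ?addr0; last first.
  by move=> j hj; rewrite ifF ?mul0r //; apply: contraNF hj => /eqP ej; apply/eqP/val_inj.
by rewrite /z'; zmod.
Qed.

Lemma division d z : L z -> pw d z ->
  exists q : nat -> R, (forall i, pw (d - shift) (q i)) /\ z = \sum_(i < N) q i * g i.
Proof.
move=> Lz hz.
(* Zero is the default when the conditions fail, so that the iteration [zs] can be defined before
   its invariant is known. *)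
have /fun_choice [st hst] : forall dz : nat * R, exists q : nat -> R, L dz.2 -> pw dz.1 dz.2 ->
   (forall i, pw (dz.1 - shift) (q i)) /\ pw dz.1.+1 (dz.2 - \sum_(i < N) q i * g i).
  move=> [d' z']; case: (classic (L z' /\ pw d' z')) => [[h1 h2]|h].
    by have [q hq] := division_step h1 h2; exists q.
  by exists (fun=> 0) => h1 h2; case: h.
pose zs := fix zs t := if t is t'.+1 then
  zs t' - \sum_(i < N) st ((d + t')%N, zs t') i * g i else z.
pose f i t := st ((d + t)%N, zs t) i.
have hzs t : L (zs t) /\ pw (d + t) (zs t).
  elim: t => [|t [IH1 IH2]] /=; first by rewrite addn0.
  split; last by rewrite addnS; case: (hst (_, _) IH1 IH2).
  apply: LB => //; apply: big_ind => // i _; apply: LM; exact: Lg.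
have hf i t : pw (d + t - shift) (f i t).
  by have [h1 h2] := hzs t; have [h _] := hst (_, _) h1 h2; exact: h.
have /fun_choice [q hq] : forall i, exists F, forall T, pw (T - shift) (F - \sum_(t < T) f i t).
  by move=> i; apply: ipow_series => t; apply: (ipow_le hA hI _ (hf i t)); lia.
exists q; split.
  move=> i; rewrite -[q i](subrK (\sum_(t < d) f i t)); apply: (ipowD hA hI) => //.
  by apply: (ipow_sum hA hI) => t _; apply: (ipow_le hA hI _ (hf i t)); lia.
apply/eqP; rewrite -subr_eq0; apply/eqP; apply: sep => K.
pose T := (K + shift)%N.
have ez : z = zs T + \sum_(i < N) (\sum_(t < T) f i t) * g i.
  elim: T => [|T IH].
    by rewrite big1 ?addr0 // => i _; rewrite big_ord0 mul0r.
  have -> : \sum_(i < N) (\sum_(t < T.+1) f i t) * g i =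
      \sum_(i < N) (\sum_(t < T) f i t) * g i + \sum_(i < N) f i T * g i.
    by rewrite -big_split; apply: eq_bigr => i _; rewrite big_ord_recr mulrDl.
  by rewrite {1}IH /=; zmod.
rewrite {1}ez -addrA -sumrB; apply: (ipowD hA hI).
  by case: (hzs T) => _; apply: (ipow_le hA hI); rewrite /T; lia.
apply: (ipow_sum hA hI) => i _; rewrite -mulrBl; apply: (ipowMr hA hI) => //.
apply: (ipowBC hA); apply: (ipow_le hA hI _ (hq i T)); rewrite /T; lia.
Qed.

End Division.

(* Artin-Rees: the loss of order [s] depends neither on [z] nor on [d]. *)
Lemma standard_basis L : left_ideal L -> exists (N : nat) (g : nat -> R) (s : nat),
  (forall i, (i < N)%N -> L (g i)) /\
  forall d z, L z -> pw d z ->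
    exists q : nat -> R, (forall i, pw (d - s) (q i)) /\ z = \sum_(i < N) q i * g i.
Proof.
move=> hL; have [Gs [hG1 hG2]] := dickson n (fun a => exists2 f, L f & lead f a).
pose G i := nth [::] Gs i.
have /fun_choice [g hg] : forall i, exists f, (i < size Gs)%N -> L f /\ lead f (G i).
  move=> i; case: (ltnP i (size Gs)) => hi; last by exists 0.
  by have [_ [f h1 h2]] := hG1 _ (mem_nth [::] hi); exists f.
have h1 i : (i < size Gs)%N -> L (g i) by case/hg.
have h2 i : (i < size Gs)%N -> lead (g i) (G i) by case/hg.
exists (size Gs), g, (shift (size Gs) G); split=> // d z Lz hz.
apply: (division hL h1 h2 _ Lz hz) => z' a Lz' la.
have [g' hg' /all2_leq_expadd [b sb ea]] : exists2 g, g \in Gs & all2 leq g a.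
  by apply: hG2; [case: la|exists z'].
exists (index g' Gs), b; split; first by rewrite index_mem.
  by rewrite sb; case: (hG1 _ hg').
by rewrite /G nth_index.
Qed.

Lemma left_noetherian L : left_ideal L -> fin_gen L.
Proof.
move=> /standard_basis [N [g [s [h1 h2]]]]; exists N, g; split=> // z Lz.
by have [q [_ hq]] := h2 0%N z Lz (ipow0 I (full z)); exists q.
Qed.

(** An element with non-zero constant term has least exponent zero, so division by it alone writes 1
    as a left multiple of it. *)
Lemma proper_coef0 (P : R -> Prop) l : left_ideal P -> ~ P 1 -> P l -> cf l (nseq n 0%N) = 0.
Proof.
move=> [_ [_ [_ hM]]] P1 Pl; apply/eqP; apply: NNPP => /negP hl.
have ll : lead l (nseq n 0%N) by apply: lead_z0.
have hfull : left_ideal (@full_set R) by do 2!split.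
have hcov (z : R) a : full_set z -> lead z a -> exists (i : nat) b,
    [/\ (i < 1)%N, size b = n & a = expadd b (nseq n 0%N)].
  by move=> _ [sa _ _]; exists 0%N, a; rewrite expadd0.
have [q [_ e]] := @division _ 1 (fun=> l) (fun=> nseq n 0%N) hfull (fun _ _ => Logic.I)
  (fun _ _ => ll) hcov 0 1 Logic.I (ipow0 I (full 1)).
by apply: P1; rewrite e big_ord1; apply: hM.
Qed.

(** Left independence over [k] modulo [L + I^N]. An arbitrary finite index type lets [T * 'I_N]
    index the products [b c^i]. *)
Definition indep_mod (L : R -> Prop) N (T : finType) := exists b : T -> R, forall c : T -> k,
  (exists2 l, L l & pw N (\sum_t iota (c t) * b t - l)) -> forall t, c t = 0.

(* Artin-Rees for the left ideal [P + R c]: cancelling [c] costs a bounded order. *)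
Lemma cancel_regular (P : R -> Prop) c : ideal P -> (forall a, P (a * c) -> P a) ->
  exists s, forall a M, (exists2 p, P p & pw M (a * c - p)) ->
    exists2 p, P p & pw (M - s) (a - p).
Proof.
move=> [_ [P0 [PD PM]]] hc.
have PMl a b : P b -> P (a * b) by move=> /(PM a _ Logic.I) [].
have PB a b : P a -> P b -> P (a - b) by move=> ha hb; apply: PD => //; rewrite -mulN1r; apply: PMl.
pose L z := exists p r, P p /\ z = p + r * c.
have [N [g [s [hg hdiv]]]] : exists (N : nat) (g : nat -> R) (s : nat),
  (forall i, (i < N)%N -> L (g i)) /\
  forall d z, L z -> pw d z ->
    exists q : nat -> R, (forall i, pw (d - s) (q i)) /\ z = \sum_(i < N) q i * g i.
  apply: standard_basis; split=> //; split; first by exists 0, 0; rewrite mul0r addr0.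
  split.
    move=> _ _ [p [r [hp ->]]] [p' [r' [hp' ->]]]; exists (p + p'), (r + r').
    by split; [exact: PD|rewrite mulrDl addrACA].
  move=> a _ _ [p [r [hp ->]]]; exists (a * p), (a * r).
  by split; [exact: PMl|rewrite mulrDr mulrA].
have /fun_choice [pr hpr] : forall i, exists pr : R * R, (i < N)%N -> P pr.1 /\ g i = pr.1 + pr.2 * c.
  move=> i; case: (ltnP i N) => hi; last by exists (0, 0).
  by have [p [r h]] := hg i hi; exists (p, r).
exists s => a M [p Pp hp].
have [q [hq e]] : exists q : nat -> R, (forall i, pw (M - s) (q i)) /\
    a * c - p = \sum_(i < N) q i * g i.
  by apply: hdiv => //; exists (- p), a; rewrite addrC; split=> //; rewrite -[- p]sub0r; apply: PB.
(* With [g i = p_i + r_i c], subtracting the [q_i r_i] from [a] leaves an element whose product with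
   [c] is in [P]. *)
exists (a - \sum_(i < N) q i * (pr i).2).
  apply: hc; rewrite mulrBl mulr_suml.
  have -> : a * c = p + \sum_(i < N) q i * g i by rewrite -e addrC subrK.
  rewrite -addrA -sumrB; apply: (PD _ _) => //; apply: (big_ind P) => [||i _]; [exact: P0|exact: PD|].
  by have [h1 ->] := hpr i (ltn_ord i); rewrite mulrDr mulrA addrK; apply: PMl.
rewrite opprB addrC subrK; apply: (ipow_sum hA hI) => i _.
exact: (ipowMr hA hI).
Qed.

(** In a relation [\sum_i q_i c^i] every term but [q_0] lies in [Q], so [q_0 = 0] by independence
    modulo [Q]. Then one [c] is cancelled at the cost [s], and the argument repeats. At most [N]
    cancellations, with precision [N] left at the end, give [(s + 1) N]. *)
Lemma growth (P Q : R -> Prop) c : ideal P -> ideal Q -> subset_of P Q -> Q c ->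
  (forall a, P (a * c) -> P a) ->
  exists s, forall N (T : finType), indep_mod Q N T ->
    indep_mod P (s.+1 * N) (T * 'I_N)%type.
Proof.
move=> hP hQ PQ Qc hc; have [s hs] := cancel_regular hP hc.
exists s => N T [b hb]; exists (fun ti : T * 'I_N => b ti.1 * c ^+ ti.2) => e [p Pp hp].
have [_ [_ [QD QM]]] := hQ.
pose q i := if insub i is Some j then \sum_t iota (e (t, j : 'I_N)) * b t else 0.
have qE (i : 'I_N) : q i = \sum_t iota (e (t, i)) * b t
    by rewrite /q (valK i).
have main D : forall (q : nat -> R) M, (N + D * s <= M)%N ->
    (forall i, (i < D)%N -> (exists2 l, Q l & pw N (q i - l)) -> q i = 0) ->
    (exists2 p, P p & pw M (\sum_(i < D) q i * c ^+ i - p)) ->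
    forall i, (i < D)%N -> q i = 0.
  elim: D => [//|D IH] w M hM hw [p' Pp' hp'].
  pose S := \sum_(i < D) w i.+1 * c ^+ i.
  have eS : \sum_(i < D.+1) w i * c ^+ i = w 0%N + S * c.
    rewrite big_ord_recl expr0 mulr1 mulr_suml; congr (_ + _).
    by apply: eq_bigr => i _; rewrite -mulrA -exprSr.
  rewrite eS in hp'.
  have w0 : w 0%N = 0.
    apply: hw => //; exists (p' - S * c).
      apply: QD; first exact: PQ.
      by rewrite -mulNr; case: (QM (- S) c Logic.I Qc).
    have -> : w 0%N - (p' - S * c) = w 0%N + S * c - p' by zmod.
    by apply: (ipow_le hA hI _ hp'); lia.
  rewrite w0 add0r in hp'.
  have hS := hs S M (ex_intro2 _ _ p' Pp' hp').
  have hw' := IH (fun i => w i.+1) (M - s)%N _ (fun i hi => hw i.+1 hi) hS.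
  by case=> [//|i] hi; apply: hw' => //; lia.
have hq0 i : (i < N)%N -> (exists2 l, Q l & pw N (q i - l)) -> q i = 0.
  move=> hi [l Ql hl]; rewrite (qE (Ordinal hi)).
  rewrite [X in pw _ (X - _)](qE (Ordinal hi)) in hl.
  by rewrite big1 // => t _; rewrite (hb _ (ex_intro2 _ _ l Ql hl)) rmorph0 mul0r.
have hqz : forall i, (i < N)%N -> q i = 0.
  apply: (main N q (s.+1 * N)%N) => //; first by rewrite mulSn mulnC.
  exists p => //; suff <- : \sum_ti iota (e ti) * (b ti.1 * c ^+ ti.2) = \sum_(i < N) q i * c ^+ i by [].
  under [RHS]eq_bigr => i _ do rewrite qE mulr_suml.
  rewrite exchange_big pair_bigA /=; apply: eq_bigr => -[t i] _ /=.
  by rewrite mulrA.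
case=> t i; have := hqz i (ltn_ord i); rewrite qE => h.
apply: (hb (fun t => e (t, i))); exists 0; first by case: hQ => _ [].
by rewrite h subrr; exact: (ipow_zero hA hI).
Qed.

(** Elimination of the last equation by a pivot [t0]. Scalars act on the left, so the multiplier
    [v t m / e] stands between [c t] and [v t0 i]. *)
Lemma left_lin_dep (T : finType) (m : nat) : forall (v : T -> nat -> k) (S : {set T}), (m < #|S|)%N ->
  exists c : T -> k, (exists2 t, t \in S & c t != 0) /\
    forall i, (i < m)%N -> \sum_(t in S) c t * v t i = 0.
Proof.
elim: m => [|m IH] v S hS.
  have /card_gt0P [t ht] := hS.
  by exists (fun=> 1); split=> //; exists t => //; exact: oner_neq0.
case: (classic (exists2 t0, t0 \in S & v t0 m != 0)) => [[t0 h0 hv]|hno]; last first.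
  have [c [hc1 hc2]] := IH v S (ltnW hS).
  exists c; split=> // i; rewrite ltnS leq_eqVlt => /orP [/eqP ->|]; last exact: hc2.
  rewrite big1 // => t ht; apply/eqP; apply: NNPP => hne; apply: hno; exists t => //.
  by apply/negP => /eqP e; apply: hne; rewrite e mulr0.
pose e := v t0 m.
have [|c [[t1 ht1 hc1] hc2]] := IH (fun t i => v t i - v t m / e * v t0 i) (S :\ t0).
  by move: hS; rewrite (cardsD1 t0) h0.
pose c0 := - \sum_(t in S :\ t0) c t * (v t m / e).
exists (fun t => if t == t0 then c0 else c t); split.
  move: ht1; rewrite !inE => /andP [ne h1]; exists t1 => //; by rewrite (negPf ne).
have hsum i : \sum_(t in S) (if t == t0 then c0 else c t) * v t i =
    \sum_(t in S :\ t0) c t * (v t i - v t m / e * v t0 i).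
  rewrite (bigD1 t0) //= eqxx /c0 mulNr mulr_suml addrC.
  rewrite (eq_bigl (fun t => t \in S :\ t0)) => [|t]; last by rewrite !inE andbC.
  rewrite -sumrB; apply: eq_bigr => t; rewrite !inE => /andP [/negPf -> _].
  by rewrite mulrBr !mulrA.
move=> i; rewrite hsum ltnS leq_eqVlt => /orP [/eqP ->|]; last exact: hc2.
by rewrite big1 // => t _; rewrite divrK ?kdiv // subrr mulr0.
Qed.

(** A larger family has a non-trivial combination without coefficients below degree [N], that is,
    one in [I^N]. *)
Lemma indep_mod_card (L : R -> Prop) N (T : finType) : L 0 -> indep_mod L N T -> (#|T| <= N ^ n)%N.
Proof.
move=> L0 [b hb]; apply: leq_trans (size_exps_below n N); rewrite leqNgt; apply/negP => hT.
have [|c [[t _ ht] hc]] := @left_lin_dep T (size (exps_below n N))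
    (fun t i => cf (b t) (nth [::] (exps_below n N) i)) [set: T].
  by rewrite cardsT.
case/eqP: ht; apply: hb; exists 0 => //; rewrite subr0; apply/ipow_coefP => a sa ha.
have haE : a \in exps_below n N by rewrite mem_exps_below sa eqxx.
have := hc (index a (exps_below n N)); rewrite index_mem haE => /(_ isT).
rewrite nth_index // => <-; rewrite (co_sum H hA) //.
by apply: eq_big => [t'|t' _]; rewrite ?inE // (coZ H).
Qed.

Lemma prime_left_ideal P : prime_ideal P -> left_ideal P.
Proof.
case=> [[h1 [h2 [h3 h4]]] _]; split=> //; split=> //; split=> // a b ha hb.
by case: (h4 a b ha hb).
Qed.

(* [N] is arbitrary and [S] is fixed, so [j] bounds the growth exponent from below. *)
Lemma chain_growth (P : nat -> R -> Prop) t : prime_chain P t ->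
  forall j, (j <= t)%N -> exists2 S, (0 < S)%N & forall N, (0 < N)%N ->
    exists2 T : finType, (N ^ j <= #|T|)%N & indep_mod (P (t - j)%N) (S * N) T.
Proof.
move=> [hpr hst]; elim=> [|j IH] hj.
  (* The family consists of 1 alone: elements of a proper ideal have no constant term. *)
  exists 1%N => // N hN; exists 'I_1; first by rewrite expn0 card_ord.
  rewrite subn0; have [hId [P1 _]] := hpr t (leqnn t).
  exists (fun=> 1) => c [l Pl]; rewrite big_ord1 mulr1 mul1n => hp i; rewrite (ord1 i).
  have := co_pow H hA hI hp (size_nseq n 0%N); rewrite sumn_nseq => /(_ hN).
  rewrite (coB H) ?size_nseq // (co_iotaE H) ?size_nseq // eqxx.
  by rewrite (proper_coef0 (prime_left_ideal (hpr t (leqnn t))) P1 Pl) subr0.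
have [S S0 hS] := IH (ltnW hj).
have e : (t - j = (t - j.+1).+1)%N by lia.
have hlt : (t - j.+1 < t)%N by lia.
have [hsub [z Qz Pz]] := hst _ hlt; rewrite -e in hsub Qz.
have hP := hpr _ (ltnW hlt); have hQ := hpr (t - j)%N (leq_subr j t).
have [QI _] := hQ; have [PI _] := hP.
have hnoeth := fun F => @max_left_ideal R F left_noetherian.
have [c Qc hc] : exists2 c, P (t - j)%N c & forall a, P (t - j.+1)%N (a * c) -> P (t - j.+1)%N a.
  by apply: (regular_elem hnoeth hP) => // h; apply: Pz; apply: h.
have [s hs] := growth PI QI hsub Qc hc.
exists (s.+1 * S)%N; first by rewrite muln_gt0.
move=> N hN; have [T hT hi] := hS N hN.
(* The family at hand has precision [S N], so its size is multiplied by [S N >= N]. *)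
exists (T * 'I_(S * N))%type; last by rewrite -mulnA; exact: hs.
by rewrite card_prod card_ord expnSr leq_mul // leq_pmull.
Qed.

Lemma upper_bound (P : nat -> R -> Prop) t : prime_chain P t -> (t <= n)%N.
Proof.
move=> hP; rewrite leqNgt; apply/negP => hnt.
have [S S0 hS] := chain_growth hP hnt.
(* The inequality [N^(n+1) <= (S N)^n] means [N <= S^n], which this [N] violates. *)
have [|T hT hi] := hS (S ^ n).+1; first by [].
have [hpr _] := hP; have [[_ [P0 _]] _] := hpr (t - n.+1)%N (leq_subr _ _).
have := leq_trans hT (indep_mod_card P0 hi).
by rewrite expnMn expnS leq_mul2r ltnn orbF expn_eq0.
Qed.

End Upper.
Theorem theorem4p4 (k : unitRingType) (R : nzRingType)
    (iota : {rmorphism k -> R}) (n : nat) :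
  (forall a : k, a != 0 -> a \is a GRing.unit) ->
  injective iota ->
  (1 <= n)%N ->
  RSPS iota n ->
  classical_krull_dim_eq R n.
Proof.
move=> kdiv iota_inj _ [Rs [m [sigma [delta [x [hR0 [hRn [hc [hE stable]]]]]]]]].
have hE' i hi := proj2 (hE i hi).
have [[cf H _] _] := tower kdiv iota_inj hR0 hc hE' stable (leqnn n).
split; first exact: (lower_bound kdiv iota_inj hR0 hRn hc hE' stable H).
have [hL [hsep _]] := hc n (leqnn n).
move=> P t; apply: (upper_bound kdiv H _ _ hRn) => [||f hf].
- by case: hL.
- by case: hL => _ [[]].
- exact: hsep.
Qed.
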